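(* Let $\sigma$ be an implicit signature. If the pseudovariety of groups $\mathsf{H}$ is $\sigma$-reducible for the pointlike problem, then the pseudovariety $\mathsf{V}=\mathsf{DO}\cap\overline{\mathsf{H}}$ is $(\sigma\cup\{\_^\omega\})$-reducible for the pointlike problem.
   Context: $\mathsf{S}$ is the pseudovariety of all finite semigroups, and for a finite set $A$, $\overline{\Omega}_A\mathsf{S}$ is the free profinite semigroup on $A$; its elements are called pseudowords. For a pseudovariety $\mathsf{V}$ of semigroups, $\overline{\Omega}_A\mathsf{V}$ is the free pro-$\mathsf{V}$ semigroup on $A$ and $p_{\mathsf{V}}:\overline{\Omega}_A\mathsf{S}\to\overline{\Omega}_A\mathsf{V}$ is the canonical projection. $\mathsf{DO}$ is the pseudovariety of all finite semigroups in which every regular $\mathcal{J}$-class is a subsemigroup isomorphic to a direct product of a rectangular band and a group. For a pseudovariety $\mathsf{H}$ of groups, $\overline{\mathsf{H}}$ is the pseudovariety of all finite semigroups all of whose subgroups lie in $\mathsf{H}$. So $\mathsf{DO}\cap\overline{\mathsf{H}}$ consists of all finite semigroups in which every regular $\mathcal{J}$-class is the product of a rectangular band by a group from $\mathsf{H}$. An implicit signature is a set $\sigma$ of pseudowords (elements of finitely generated free profinite semigroups, viewed as implicit operations) that contains binary multiplication. Pseudowords have a natural interpretation as operations on every profinite semigroup, so every profinite semigroup is a $\sigma$-algebra; $\Omega^\sigma_A\mathsf{S}$ is the $\sigma$-subalgebra of $\overline{\Omega}_A\mathsf{S}$ generated by $A$. The operation $\_^\omega$ is the unary operation which in a finite semigroup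 maps $x$ to its unique idempotent power $x^\omega$. A nonempty subset $P$ of a finite semigroup $S$ is $\mathsf{V}$-pointlike if for every finite set $A$ and every onto continuous homomorphism $\varphi:\overline{\Omega}_A\mathsf{S}\to S$ there is a subset $P'\subseteq\overline{\Omega}_A\mathsf{S}$ such that $\varphi(P')=P$ and $p_{\mathsf{V}}(P')$ is a singleton. The pseudovariety $\mathsf{V}$ is $\sigma$-reducible for the pointlike problem if, for every finite semigroup $S$, every $\mathsf{V}$-pointlike subset $P$ of $S$ and every such $\varphi$, the set $P'$ can be chosen to be a subset of $\Omega^\sigma_A\mathsf{S}$. *)

(* Defs.v *)
From HB Require Import structures.
From mathcomp Require Import all_boot all_fingroup.
From mathcomp Require Import all_classical.
From mathcomp Require Import topology.

Set Implicit Arguments.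
Unset Strict Implicit.
Unset Printing Implicit Defensive.

Import GroupScope.
Local Open Scope classical_set_scope.

(* Semigroups are nonempty, as usual in the theory of pseudovarieties. *)
Record finSemigroup := FinSemigroup {
  fsg_fin : finType;
  fsg_op : fsg_fin -> fsg_fin -> fsg_fin;
  fsg_opA : associative fsg_op;
  fsg_inh : inhabited fsg_fin }.

Definition fsg_sort (S : finSemigroup) : Type := fsg_fin S.
Coercion fsg_sort : finSemigroup >-> Sortclass.

HB.instance Definition _ (S : finSemigroup) := Finite.on (fsg_sort S).
HB.instance Definition _ (S : finSemigroup) :=
  isSemigroup.Build (fsg_sort S) (@fsg_opA S).

Lemma prodsg_inh (S T : finSemigroup) : inhabited (S * T)%type.
Proof. by case: (fsg_inh S) => x; case: (fsg_inh T) => y; split; exact: (x, y). Qed.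

Definition prodsg (S T : finSemigroup) : finSemigroup :=
  @FinSemigroup (S * T)%type _ (@mulgA (S * T)%type) (prodsg_inh S T).

Definition is_group (S : finSemigroup) : Prop :=
  exists (e : S) (inv : S -> S), left_id e *%g /\ left_inverse e inv *%g.

Definition sgclass := finSemigroup -> Prop.

(* Closure under the empty product is closure under one-element semigroups;
   it also makes the class nonempty.  Subsemigroups are given by injective
   homomorphisms, so that the class is closed under isomorphism. *)
Record pseudovariety (V : sgclass) : Prop := Pseudovariety {
  pv_triv : forall S : finSemigroup, #|{: S}| = 1%N -> V S;
  pv_prod : forall S T : finSemigroup, V S -> V T -> V (prodsg S T);
  pv_sub : forall (S T : finSemigroup) (f : {multiplicative T -> S}),
    injective f -> V S -> V T;
  pv_quo : forall (S T : finSemigroup) (f : {multiplicative S -> T}),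
    (forall t, exists s, f s = t) -> V S -> V T }.

Definition group_pseudovariety (H : sgclass) : Prop :=
  pseudovariety H /\ (forall S, H S -> is_group S).

Definition pvS : sgclass := fun=> True.

(* x \in S^1 y S^1 *)
Definition leJ (S : semigroupType) (x y : S) : Prop :=
  [\/ x = y, exists a, x = a * y, exists b, x = y * b |
      exists a b, x = a * y * b].

Definition Jclass (S : semigroupType) (x : S) : set S :=
  [set y | leJ x y /\ leJ y x].

Definition regular (S : semigroupType) (x : S) : Prop :=
  exists y, x = x * y * x.

Definition rectangular_band (B : finSemigroup) : Prop :=
  (forall x : B, x * x = x) /\ (forall x y : B, x * y * x = x).

Definition DO : sgclass := fun S =>
  forall x : S, regular x ->
    exists (B : finSemigroup) (G : finGroupType)
           (f : {multiplicative (B * G)%type -> S}),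
      [/\ rectangular_band B, injective f & range f = Jclass x].

(* The subgroups of S, up to isomorphism, are the groups embedding in S. *)
Definition Hbar (H : sgclass) : sgclass := fun S =>
  forall (G : finSemigroup) (f : {multiplicative G -> S}),
    injective f -> is_group G -> H G.

Definition pvI (V W : sgclass) : sgclass := fun S => V S /\ W S.

(* Every finite semigroup is isomorphic to one given by a multiplication table
   on an ordinal.  Restricting to those makes the projective limit below a
   product over a small index type. *)
Record table := Table {
  tab_pred : nat;
  tab_op : 'I_tab_pred.+1 -> 'I_tab_pred.+1 -> 'I_tab_pred.+1;
  tab_opA : associative tab_op }.

Definition tabsg (t : table) : finSemigroup :=
  FinSemigroup (@tab_opA t) (inhabits ord0).
Coercion tabsg : table >-> finSemigroup.

Record evaluation (V : sgclass) (A : finType) := Evaluation {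
  ev_sg : table;
  ev_in : V ev_sg;
  ev_fun : A -> ev_sg }.
Coercion ev_sg : evaluation >-> table.

HB.instance Definition _ V A := gen_eqMixin (evaluation V A).
HB.instance Definition _ V A := gen_choiceMixin (evaluation V A).

(* The limit of all the evaluations A -> S with S in V, along all the
   homomorphisms between them: an element is an A-ary implicit operation on V,
   i.e. a family of operations x_S : S^A -> S that commutes with homomorphisms.
   The topology is that of pointwise convergence, the S being discrete.
   The components at evaluations that do not generate S are determined by those
   that do, so that this is the usual limit of the A-generated semigroups in V;
   see pfree_compact, pfree_mul_continuous, pfree_extend, pfree_dense below. *)
Definition evprod (V : sgclass) (A : finType) : Type :=
  prod_topology (fun i : evaluation V A => discrete_topology i).

HB.instance Definition _ V A := Topological.on (evprod V A).

Definition implicit_op V A : set (evprod V A) := [set x |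
  forall (i j : evaluation V A) (h : {multiplicative i -> j}),
    (forall a, h (ev_fun i a) = ev_fun j a) -> h (x i) = x j].

Definition pfree V A : Type := set_type (@implicit_op V A).

HB.instance Definition _ V A := Topological.on (pfree V A).

Section PFree.
Variables (V : sgclass) (A : finType).

Definition coord (i : evaluation V A) (x : pfree V A) : i := set_val x i.

Lemma coord_hom (x : pfree V A) (i j : evaluation V A)
    (h : {multiplicative i -> j}) :
  (forall a, h (ev_fun i a) = ev_fun j a) -> h (coord i x) = coord j x.
Proof. by move=> hE; apply: (set_mem (valP x)). Qed.

Definition mkpfree (x : evprod V A) (xP : implicit_op x) : pfree V A :=
  exist _ x (mem_set xP).

Lemma pfree_ext (x y : pfree V A) : (forall i, coord i x = coord i y) -> x = y.
Proof. by move=> xy; apply: val_inj; apply: functional_extensionality_dep. Qed.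

Lemma pfree_mul_subproof (x y : pfree V A) :
  implicit_op ((fun i => coord i x * coord i y) : evprod V A).
Proof. by move=> i j h hE; rewrite gmulfM !(coord_hom _ hE). Qed.

Definition pfree_mul x y := mkpfree (pfree_mul_subproof x y).

Lemma pfree_mulA : associative pfree_mul.
Proof. by move=> x y z; apply: pfree_ext => i; apply: mulgA. Qed.

HB.instance Definition _ := isSemigroup.Build (pfree V A) pfree_mulA.

Lemma pfree_gen_subproof (a : A) :
  implicit_op ((fun i => ev_fun i a) : evprod V A).
Proof. by move=> i j h hE; apply: hE. Qed.

Definition pfree_gen a := mkpfree (pfree_gen_subproof a).

End PFree.

Lemma coord_continuous V A (i : evaluation V A) :
  continuous (coord i : pfree V A -> discrete_topology i).
Proof.
move=> x; apply: (@continuous_comp _ _ _ (set_val : pfree V A -> evprod V A)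
  (fun y : evprod V A => y i : discrete_topology i)).
  exact: initial_continuous.
exact: (@proj_continuous _ (fun j : evaluation V A => discrete_topology j) i).
Qed.

Section TableOf.
Variable S : finSemigroup.

Lemma table_of_card : #|{: S}| = #|{: S}|.-1.+1.
Proof. by rewrite prednK //; case: (fsg_inh S) => x; apply/card_gt0P; exists x. Qed.

Let enc (s : S) := cast_ord table_of_card (enum_rank s).
Let dec k : S := enum_val (cast_ord (esym table_of_card) k).

Let encK : cancel enc dec.
Proof. by move=> s; rewrite /dec /enc cast_ordK enum_rankK. Qed.

Lemma table_of_opA : associative (fun k l => enc (dec k * dec l)).
Proof. by move=> k l m; rewrite !encK mulgA. Qed.

Definition table_of : table := Table table_of_opA.

Definition tenc (s : S) : table_of := enc s.
Definition tdec (k : table_of) : S := dec k.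

Lemma tencK : cancel tenc tdec.
Proof. exact: encK. Qed.

Lemma tdecK : cancel tdec tenc.
Proof. by move=> k; rewrite /tdec /tenc /dec /enc enum_valK cast_ordKV. Qed.

HB.instance Definition _ := isMultiplicative.Build _ _ tdec
  (fun x y => encK (dec x * dec y)).

End TableOf.

Lemma pfree_extend V (A : finType) (T : finSemigroup) (g : A -> T) :
  pseudovariety V -> V T ->
  exists phi : {multiplicative pfree V A -> T},
    continuous (phi : pfree V A -> discrete_topology T) /\
    forall a, phi (pfree_gen V a) = g a.
Proof.
move=> Vpv VT.
pose i : evaluation V A := @Evaluation V A (table_of T)
  (pv_sub Vpv (f := @tdec T) (can_inj (@tdecK T)) VT) (fun a => tenc (g a)).
have hM : {morph (fun x : pfree V A => tdec (coord i x)) : x y / x * y >-> x * y}.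
  by move=> x y; exact: tencK.
pose phi : {multiplicative pfree V A -> T} :=
  HB.pack (fun x : pfree V A => tdec (coord i x))
    (isMultiplicative.Build _ _ _ hM).
exists phi.
split=> [|a]; last exact: tencK.
move=> x; apply: (@continuous_comp _ _ _ (coord i : _ -> discrete_topology i)
  (@tdec T : discrete_topology i -> discrete_topology T)).
  exact: coord_continuous.
by apply/discrete_cvg; exact/principal_filterP.
Qed.

Inductive gen_words V A : set (pfree V A) :=
| gen_words_var a : gen_words (pfree_gen V a)
| gen_words_mul x y : gen_words x -> gen_words y -> gen_words (x * y).

Section Dense.
Variables (V : sgclass) (A : finType) (Vpv : pseudovariety V).

Lemma sub_table (S : finSemigroup) (P : set S) : V S -> P !=set0 ->
  (forall x y, P x -> P y -> P (x * y)) ->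
  exists (t : table) (f : {multiplicative t -> S}),
    [/\ V t, injective f & range f = P].
Proof.
move=> VS [x0 Px0] PM.
pose T : finType := {x : S | x \in P}.
have memM (x y : T) : val x * val y \in P.
  by apply/mem_set; apply: PM; apply: set_mem; apply: valP.
pose op (x y : T) : T := Sub (val x * val y) (memM x y).
have opA : associative op.
  by move=> x y z; apply: val_inj; rewrite !SubK mulgA.
pose U := FinSemigroup opA (inhabits (Sub x0 (mem_set Px0))).
pose f (k : table_of U) : S := val (tdec k : T).
have fM : {morph f : x y / x * y}.
  by move=> x y; rewrite /f gmulfM.
pose F : {multiplicative table_of U -> S} :=
  HB.pack f (isMultiplicative.Build _ _ f fM).
have injf : injective F.
  by move=> x y /val_inj; apply: (can_inj (@tdecK U)).
exists (table_of U), F; split=> //; first exact: (pv_sub Vpv (f := F)).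
apply/seteqP; split=> [_ [k _ <-]|x Px]; first exact/set_mem/valP.
exists (tenc (Sub x (mem_set Px) : U)) => //.
by rewrite /F /= /f tencK SubK.
Qed.

Lemma coord_gen_words (a0 : A) (i : evaluation V A) (x : pfree V A) :
  exists2 u, gen_words u & coord i u = coord i x.
Proof.
pose P : set i := [set coord i u | u in @gen_words V A].
have P0 : P !=set0 by exists (coord i (pfree_gen V a0)); eexists; [left|].
have PM s t : P s -> P t -> P (s * t).
  by move=> [u gu <-] [v gv <-]; exists (u * v); [right|].
have [t [f [Vt finj fP]]] := sub_table (ev_in i) P0 PM.
have gP a : exists k, f k = ev_fun i a.
  have : P (ev_fun i a) by exists (pfree_gen V a) => //; left.
  by rewrite -fP => -[k _ <-]; exists k.
pose g a := projT1 (cid (gP a)).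
pose j : evaluation V A := @Evaluation V A t Vt g.
have : P (coord i x).
  rewrite -(@coord_hom _ _ x j i f) => [|a]; last exact: projT2 (cid (gP a)).
  by rewrite -fP; exists (coord j x).
by case=> u gu uE; exists u.
Qed.

Lemma ev_join (i j : evaluation V A) : exists k : evaluation V A,
  forall x y : pfree V A, coord k x = coord k y ->
    coord i x = coord i y /\ coord j x = coord j y.
Proof.
pose T := prodsg i j.
have VT : V T by apply: (pv_prod Vpv); exact: ev_in.
pose k : evaluation V A := @Evaluation V A (table_of T)
  (pv_sub Vpv (f := @tdec T) (can_inj (@tdecK T)) VT)
  (fun a => tenc ((ev_fun i a, ev_fun j a) : T)).
have f1M : {morph (fun z : k => (tdec z : T).1) : x y / x * y}.
  by move=> x y; rewrite gmulfM.
have f2M : {morph (fun z : k => (tdec z : T).2) : x y / x * y}.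
  by move=> x y; rewrite gmulfM.
pose F1 : {multiplicative k -> i} := 
  HB.pack (fun z : k => (tdec z : T).1) (isMultiplicative.Build _ _ _ f1M).
pose F2 : {multiplicative k -> j} := 
  HB.pack (fun z : k => (tdec z : T).2) (isMultiplicative.Build _ _ _ f2M).
exists k => x y kxy; split.
  have F1E a : F1 (ev_fun k a) = ev_fun i a by rewrite /F1 /= tencK.
  by rewrite -!(coord_hom _ F1E) kxy.
have F2E a : F2 (ev_fun k a) = ev_fun j a by rewrite /F2 /= tencK.
by rewrite -!(coord_hom _ F2E) kxy.
Qed.

Lemma nbhs_pfree (x : pfree V A) (U : set (pfree V A)) : nbhs x U ->
  exists i : evaluation V A, forall y, coord i y = coord i x -> U y.
Proof.
pose F : set_system (evprod V A) := [set W | exists i : evaluation V A,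
  forall y : pfree V A, coord i y = coord i x -> W (set_val y)].
have FF : Filter F.
  split.
  - pose one := fun _ _ : 'I_1 => ord0 : 'I_1.
    have oneA : associative one by [].
    have Vone : V (Table oneA) by apply: (pv_triv Vpv); rewrite card_ord.
    by exists (@Evaluation V A (Table oneA) Vone (fun=> ord0)).
  - move=> W W' [i iW] [j jW]; have [k kij] := ev_join i j.
    by exists k => y /kij[yi yj]; split; [exact: iW|exact: jW].
  - by move=> W W' WW' [i iW]; exists i => y /iW; exact: WW'.
have Fx : F --> (set_val x : evprod V A).
  apply/cvg_sup => i W [W' [[O oO <-] Ox] OW]; exists i => y yx; apply: OW.
  by rewrite /= -[set_val y i]/(coord i y) yx.
case=> _ [[W oW <-] Wx WU].
have [i iW] : F W by apply: Fx; exact: open_nbhs_nbhs.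
by exists i => y /iW; exact: WU.
Qed.

Lemma pfree_dense (a0 : A) : dense (@gen_words V A).
Proof.
move=> O [x Ox] oO; have [i iO] := nbhs_pfree (open_nbhs_nbhs (conj oO Ox)).
by have [u gu ux] := coord_gen_words a0 i x; exists u; split=> //; exact: iO.
Qed.

Lemma pfree_extend_uniq (a0 : A) (T : finSemigroup)
    (phi psi : {multiplicative pfree V A -> T}) :
  continuous (phi : pfree V A -> discrete_topology T) ->
  continuous (psi : pfree V A -> discrete_topology T) ->
  (forall a, phi (pfree_gen V a) = psi (pfree_gen V a)) -> phi =1 psi.
Proof.
move=> phic psic pp x.
have /nbhs_pfree[i iU] : nbhs x [set y | phi y = phi x /\ psi y = psi x].
  apply: filterI; [apply: (phic x [set phi x])|apply: (psic x [set psi x])];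
    exact: (@discrete_set1 (discrete_topology T)).
have [u gu /iU[<- <-]] := coord_gen_words a0 i x.
by elim: gu => [|v w _ IHv _ IHw]; rewrite ?gmulfM ?IHv ?IHw.
Qed.

Lemma pfree_compact : compact [set: pfree V A].
Proof.
rewrite compact_ultra => F FU _.
have FF : ProperFilter F by apply: ultra_proper.
have ex_s (i : evaluation V A) : exists t, F [set y | coord i y = t].
  have : compact [set: discrete_topology i] by apply: finite_compact; exact: finite_finset.
  case/(_ (coord i @ F) (fmap_proper_filter _ FF) (@filterT _ F _)) => t [_ Ft].
  exists t; case: (in_ultra_setVsetC [set y | coord i y = t] FU) => // nFt.
  by case: (Ft (~` [set t]) [set t] nFt (@discrete_set1 (discrete_topology i) t)) => u [].
pose s i := projT1 (cid (ex_s i)).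
have sF i : F [set y | coord i y = s i] := projT2 (cid (ex_s i)).
have sP : implicit_op (s : evprod V A).
  move=> i j h hE.
  have [y [yi yj]] := filter_ex (filterI (sF i) (sF j)).
  by rewrite -yi -yj; exact: coord_hom.
exists (mkpfree sP); split=> // U /nbhs_pfree[i iU].
by apply: filterS (sF i) => y yi; apply: iU.
Qed.

Lemma pfree_mul_continuous :
  continuous (fun p : pfree V A * pfree V A => p.1 * p.2).
Proof.
move=> [x y] U /nbhs_pfree[i iU].
have ci z : nbhs z [set z' : pfree V A | coord i z' = coord i z].
  apply: (@coord_continuous V A i z [set coord i z]).
  exact: (@discrete_set1 (discrete_topology i)).
exists ([set z | coord i z = coord i x], [set z | coord i z = coord i y]) => //.
by move=> [x' y'] /= [xx yy]; apply: iU; exact: (congr2 *%g xx yy).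
Qed.

End Dense.

Notation pseudoword := (pfree pvS).

Definition ev_forget V A (i : evaluation V A) : evaluation pvS A :=
  @Evaluation pvS A i I (ev_fun i).

Lemma pfree_proj_subproof V A (x : pseudoword A) :
  implicit_op ((fun i => coord (ev_forget i) x) : evprod V A).
Proof.
by move=> i j h hE; apply: (@coord_hom _ _ x (ev_forget i) (ev_forget j) h).
Qed.

Definition pfree_proj V A (x : pseudoword A) : pfree V A :=
  mkpfree (@pfree_proj_subproof V A x).
Arguments pfree_proj V {A} x.

(* interp w f is the value at f of the operation that w induces on the profinite
   semigroup of pseudowords over A, i.e. the image of w under the continuous
   homomorphism extending f; it is computed componentwise. *)
Definition ev_subst A n (f : 'I_n -> pseudoword A) (i : evaluation pvS A) :
  evaluation pvS 'I_n := @Evaluation pvS 'I_n i I (fun k => coord i (f k)).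

Lemma interp_subproof A n (w : pseudoword 'I_n) (f : 'I_n -> pseudoword A) :
  implicit_op ((fun i => coord (ev_subst f i) w) : evprod pvS A).
Proof.
move=> i j h hE; apply: (@coord_hom _ _ w (ev_subst f i) (ev_subst f j) h) => k.
exact: (@coord_hom _ _ (f k) i j h hE).
Qed.

Definition interp A n (w : pseudoword 'I_n) (f : 'I_n -> pseudoword A) :
  pseudoword A := mkpfree (interp_subproof w f).

Lemma interp_gen A n (f : 'I_n -> pseudoword A) k : interp (pfree_gen pvS k) f = f k.
Proof. exact: pfree_ext. Qed.

Lemma interp_mul A n (v w : pseudoword 'I_n) (f : 'I_n -> pseudoword A) :
  interp (v * w) f = interp v f * interp w f.
Proof. exact: pfree_ext. Qed.

(* The alphabets of the pseudowords in a signature are normalized to 'I_n. *)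
Definition signature := set {n : nat & pseudoword 'I_n}.

Definition implicit_op_of n (w : pseudoword 'I_n) : {n & pseudoword 'I_n} :=
  Tagged (fun n => pseudoword 'I_n) w.

Definition mul_op : {n & pseudoword 'I_n} :=
  implicit_op_of (pfree_gen pvS (ord0 : 'I_2) * pfree_gen pvS (ord_max : 'I_2)).

Definition implicit_signature (sigma : signature) : Prop := sigma mul_op.

Inductive sigma_gen (sigma : signature) (A : finType) : set (pseudoword A) :=
| sigma_gen_var a : sigma_gen sigma (pfree_gen pvS a)
| sigma_gen_op n (w : pseudoword 'I_n) (f : 'I_n -> pseudoword A) :
    sigma (implicit_op_of w) -> (forall k, sigma_gen sigma (f k)) ->
    sigma_gen sigma (interp w f).

(* sgexp x n = x ^ n for n > 0 *)
Definition sgexp (S : semigroupType) (x : S) n : S :=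
  iter n.-1 (fun y => x * y) x.

Section Exp.
Variables (S : semigroupType).
Implicit Types x : S.

Lemma sgexpS x n : (0 < n)%N -> sgexp x n.+1 = x * sgexp x n.
Proof. by case: n. Qed.

Lemma sgexpD x m n : (0 < m)%N -> (0 < n)%N ->
  sgexp x (m + n) = sgexp x m * sgexp x n.
Proof.
case: m => // m _ n0; elim: m => [|m IHm]; first by rewrite add1n sgexpS.
by rewrite addSn sgexpS // IHm mulgA.
Qed.

Lemma sgexpM x m n : (0 < m)%N -> (0 < n)%N ->
  sgexp x (m * n) = sgexp (sgexp x m) n.
Proof.
move=> m0; case: n => // n _; elim: n => [|n IHn]; first by rewrite muln1.
by rewrite mulnS sgexpD ?muln_gt0 ?m0 // IHn -sgexpS.
Qed.

Lemma sgexp_idem x n : x * x = x -> sgexp x n = x.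
Proof.
move=> xx; case: n => // n; elim: n => // n IHn.
by rewrite sgexpS // IHn.
Qed.

Lemma sgexp_idem_uniq x m n : (0 < m)%N -> (0 < n)%N ->
  sgexp x m * sgexp x m = sgexp x m -> sgexp x n * sgexp x n = sgexp x n ->
  sgexp x m = sgexp x n.
Proof.
move=> m0 n0 em en.
by rewrite -(sgexp_idem n em) -(sgexp_idem m en) -!sgexpM // mulnC.
Qed.

End Exp.

Lemma sgexp_morph (S T : semigroupType) (h : {multiplicative S -> T}) x n :
  h (sgexp x n) = sgexp (h x) n.
Proof.
case: n => // n; elim: n => // n IHn.
by rewrite (sgexpS x (ltn0Sn n)) (sgexpS _ (ltn0Sn n)) gmulfM IHn.
Qed.

(* The idempotent power of x; that x ^ #|S|! is idempotent is omega_pow_idem. *)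
Definition omega_pow (S : finSemigroup) (x : S) : S := sgexp x (#|{: S}|)`!.

Lemma omega_pow_idem (S : finSemigroup) (x : S) :
  omega_pow x * omega_pow x = omega_pow x.
Proof.
rewrite /omega_pow; set n := #|{: S}|.
have : ~~ injectiveb (fun k : 'I_n.+1 => sgexp x k.+1).
  apply/negP => /injectiveP /leq_card; rewrite card_ord -/n.
  by rewrite ltnn.
case/injectivePn => i0 [j0 ij0 eij0].
have [i [j [ij jn eij]]] : exists i j, [/\ (i < j)%N, (j <= n)%N &
    sgexp x i.+1 = sgexp x j.+1].
  case: (ltngtP i0 j0) ij0 => [lt|lt|/val_inj->]; last by rewrite eqxx.
  - by exists i0, j0; split => //; rewrite -ltnS.
  - by exists j0, i0; split => //; rewrite -ltnS.
have per m k : (i < m)%N -> sgexp x (m + k * (j - i)) = sgexp x m.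
  move=> im; elim: k => [|k IHk]; first by rewrite addn0.
  rewrite mulSn addnA -[RHS]IHk.
  have -> : (m + (j - i) = j.+1 + (m - i.+1))%N.
    by rewrite -{1}(subnKC im) addnAC addSn subnKC // ltnW.
  have -> : (m + k * (j - i) = i.+1 + (m - i.+1 + k * (j - i)))%N.
    by rewrite addnA subnKC.
  rewrite -addnA.
  case: (m - i.+1 + k * (j - i))%N => [|r]; first by rewrite !addn0 eij.
  by rewrite !sgexpD // eij.
have f0 := fact_gt0 n.
have /dvdnP[k kE] : (j - i %| n`!)%N.
  by rewrite dvdn_fact // subn_gt0 ij (leq_trans (leq_subr _ _) jn).
rewrite -sgexpD // {2}kE per //.
apply: leq_trans (leq_trans ij jn) _.
have n0 : (0 < n)%N by apply: leq_trans (leq_trans ij jn).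
by rewrite dvdn_leq // dvdn_fact // n0 leqnn.
Qed.

Lemma omega_pow_morph (S T : finSemigroup) (h : {multiplicative S -> T}) x :
  h (omega_pow x) = omega_pow (h x).
Proof.
rewrite /omega_pow sgexp_morph; apply: sgexp_idem_uniq; rewrite ?fact_gt0 //.
  by rewrite -sgexp_morph -gmulfM omega_pow_idem.
exact: omega_pow_idem.
Qed.

Lemma omega_subproof : implicit_op
  ((fun i => omega_pow (ev_fun i ord0)) : evprod pvS 'I_1).
Proof. by move=> i j h hE; rewrite omega_pow_morph hE. Qed.

Definition omega_op : {n & pseudoword 'I_n} :=
  implicit_op_of (mkpfree omega_subproof).

Definition onto_continuous (A : finType) (S : finSemigroup)
    (phi : {multiplicative pseudoword A -> S}) : Prop :=
  range phi = setT /\ continuous (phi : pseudoword A -> discrete_topology S).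

Definition is_singleton (T : Type) (X : set T) : Prop := exists y, X = [set y].

Definition pointlike (V : sgclass) (S : finSemigroup) (P : set S) : Prop :=
  P !=set0 /\
  forall (A : finType) (phi : {multiplicative pseudoword A -> S}),
    onto_continuous phi ->
    exists P' : set (pseudoword A),
      phi @` P' = P /\ is_singleton (pfree_proj V @` P').

Definition pointlike_reducible (sigma : signature) (V : sgclass) : Prop :=
  forall (S : finSemigroup) (P : set S), pointlike V P ->
  forall (A : finType) (phi : {multiplicative pseudoword A -> S}),
    onto_continuous phi ->
    exists P' : set (pseudoword A),
      [/\ P' `<=` @sigma_gen sigma A, phi @` P' = P &
          is_singleton (pfree_proj V @` P')].

(* Main.v *)
(* A V-pointlike set, for V = DO /\ Hbar, consists of the values of words w_i that
   cannot be told apart by a suitable semigroup of V. Words equal in a large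
   enough semigroup of V have the same content, the same last letter a to make
   its first occurrence, and prefixes and suffixes around that occurrence that
   are equal in a prescribed semigroup of V, because V is closed under
   T |-> T + T^1 x T^1 (see focc); dually for last occurrences. Factors of
   smaller content are handled by induction. If cutting off factors of full
   content alternately on the left and on the right can be continued long
   enough, then by finiteness the tuple (w_i) has the value of
   (p_i e_i^omega m_i f_i^omega q_i), where the m_i are equal in a semigroup of
   H. The e_i and f_i are replaced by words given by the induction and the m_i
   by sigma-words z_i with equal images over H. In a semigroup of DO the map
   t |-> E t E is a homomorphism from the elements J-above an idempotent E to
   the maximal subgroup of E, so the e_i^omega z_i f_i^omega have equal images
   over V. *)
Require Import Defs.
From HB Require Import structures.
From mathcomp Require Import all_boot all_fingroup all_classical topology.

Set Implicit Arguments.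
Unset Strict Implicit.
Unset Printing Implicit Defensive.

Import GroupScope.
Local Open Scope classical_set_scope.

(** Serves to rewrite with [x * y = z] inside products associated to the right. *)
Lemma mulg_rwl (S : semigroupType) (x y z : S) :
  x * y = z -> forall w, x * (y * w) = z * w.
Proof. by move=> <- w; rewrite mulgA. Qed.

Lemma mulg_rwl3 (S : semigroupType) (x y z u : S) :
  x * (y * z) = u -> forall w, x * (y * (z * w)) = u * w.
Proof. by move=> <- w; rewrite !mulgA. Qed.

(** * Monoids in which J-equivalent idempotents absorb each other *)

Section Orthodox.
Variable M : monoidType.
Implicit Types x y t e f g : M.

Definition leM x y := exists a b, x = a * y * b.

Definition eqJ x y := leM x y /\ leM y x.

(** For a finite semigroup [S], this condition on [adj1 S] amounts to membership in [DO]; see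
    [DO_orthodox] and [orthodox_DO]. *)
Definition orthodox := forall e f,
  e * e = e -> f * f = f -> eqJ e f -> e * f * e = e.

Lemma leM_refl x : leM x x.
Proof. by exists 1, 1; rewrite mul1g mulg1. Qed.

Lemma leM_trans y x z : leM x y -> leM y z -> leM x z.
Proof.
by move=> [a [b ->]] [c [d ->]]; exists (a * c), (d * b); rewrite !mulgA.
Qed.

Lemma leM_mull x y : leM (x * y) y.
Proof. by exists x, 1; rewrite mulg1. Qed.

Lemma leM_mulr x y : leM (x * y) x.
Proof. by exists 1, y; rewrite mul1g. Qed.

Lemma eqJ_refl x : eqJ x x.
Proof. by split; exact: leM_refl. Qed.

Lemma eqJ_sym x y : eqJ x y -> eqJ y x.
Proof. by case. Qed.

Lemma eqJ_trans y x z : eqJ x y -> eqJ y z -> eqJ x z.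
Proof. by move=> [? ?] [? ?]; split; apply: (leM_trans (y := y)). Qed.

Hypothesis orthM : orthodox.

Definition idemJ e f := f * f = f /\ eqJ e f.

Lemma idemJ_absorb e f g : idemJ e f -> idemJ e g -> f * g * f = f.
Proof.
by move=> [ff ef] [gg eg]; apply: orthM => //; apply: eqJ_trans eg; exact: eqJ_sym.
Qed.

(** Writing e = p t q, the witness is r = q e p. *)
Lemma ge_idem_inverse e t : e * e = e -> leM e t ->
  exists r, r * t * r = r /\ eqJ e r.
Proof.
move=> ee [p [q eE]]; exists (q * e * p).
have ptq : p * (t * q) = e by rewrite mulgA.
have [eeA ptqA] := (mulg_rwl ee, mulg_rwl3 ptq).
split; first by rewrite -!mulgA ptqA !eeA.
split; last by exists q, p.
by exists (p * t), (t * q); rewrite -!mulgA ptqA eeA ptq ee.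
Qed.

Lemma inverse_idemJ e r t : r * t * r = r -> eqJ e r ->
  idemJ e (r * t) /\ idemJ e (t * r).
Proof.
move=> rtr er; have rt : eqJ e (r * t).
  apply: eqJ_trans er _; split; last exact: leM_mulr.
  by rewrite -{1}rtr; exact: leM_mulr.
have tr : eqJ e (t * r).
  apply: eqJ_trans er _; split; last exact: leM_mull.
  by rewrite -{1}rtr -mulgA; exact: leM_mull.
by split; split=> //; rewrite -!mulgA ?(mulgA r) ?rtr // mulgA rtr.
Qed.

(** Take weak inverses r of t and r' of t'. The idempotents r t and t' r' are J-equivalent to e, so
    r t = (r t)(t' r')(r t), which makes t t' a factor of r. *)
Lemma leM_mul e t t' : e * e = e -> leM e t -> leM e t' -> leM e (t * t').
Proof.
move=> ee /(ge_idem_inverse ee)[r [rtr er]] /(ge_idem_inverse ee)[r' [rtr' er']].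
have [rt _] := inverse_idemJ rtr er; have [_ tr'] := inverse_idemJ rtr' er'.
apply: (leM_trans (y := r)); first by case: er.
exists r, (r' * (r * t) * r).
by rewrite -[in LHS]rtr -[in LHS](idemJ_absorb rt tr') !mulgA.
Qed.

Lemma idemJ_refl e : e * e = e -> idemJ e e.
Proof. by move=> ee; split=> //; exact: eqJ_refl. Qed.

Lemma idemJ_mul e f g : e * e = e -> idemJ e f -> idemJ e g -> idemJ e (f * g).
Proof.
move=> ee ef eg; split.
  by rewrite mulgA (idemJ_absorb ef eg).
split; first by apply: leM_mul => //; [case: ef => _ []|case: eg => _ []].
by apply: leM_trans (leM_mulr f g) _; case: ef => _ [].
Qed.

(** Replace h by h f h; then g h is an idempotent of the same J-class, absorbed between two copies
    of f. *)
Lemma idemJ_mid e f g h : e * e = e -> idemJ e f -> idemJ e g -> idemJ e h ->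
  f * g * h = f * h.
Proof.
move=> ee ef eg eh; rewrite -{1}(idemJ_absorb eh ef) !mulgA -(mulgA f g).
by rewrite (idemJ_absorb ef (idemJ_mul ee eg eh)).
Qed.

(** With r a weak inverse of x = e t, absorption gives x (r e) = e, so r e x is idempotent and fixes
    x on the right. *)
Lemma idemJ_mulr e t : e * e = e -> leM e t ->
  exists2 f, idemJ e f & e * t * f = e * t.
Proof.
move=> ee et; set x := e * t; have xE : x = e * t by []; clearbody x.
have ex : leM e x by rewrite xE; apply: leM_mul => //; exact: leM_refl.
have [r [rxr er]] := ge_idem_inverse ee ex.
have [_ xr] := inverse_idemJ rxr er.
have eE : x * (r * e) = e.
  by rewrite mulgA -{2}(idemJ_absorb (idemJ_refl ee) xr) xE !mulgA ee.
have xe := mulg_rwl3 eE; have exx : e * x = x by rewrite xE mulgA ee.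
exists (r * e * x); last by rewrite -!mulgA xe.
split; first by rewrite -!mulgA xe !exx.
split; last exact: leM_trans (leM_mulr _ x) (leM_mull r e).
by exists x, (r * e); rewrite -!mulgA xe eE ee.
Qed.

Lemma idemJ_mull e t : e * e = e -> leM e t ->
  exists2 f, idemJ e f & f * (t * e) = t * e.
Proof.
move=> ee et; set x := t * e; have xE : x = t * e by []; clearbody x.
have ex : leM e x by rewrite xE; apply: leM_mul => //; exact: leM_refl.
have [r [rxr er]] := ge_idem_inverse ee ex.
have [rx _] := inverse_idemJ rxr er.
have eE : e * (r * x) = e.
  by rewrite -{2}(idemJ_absorb (idemJ_refl ee) rx) xE -!mulgA ee.
have xee : x * e = x by rewrite xE -mulgA ee.
exists (x * (e * r)); last by rewrite -!mulgA eE.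
split; first by rewrite -!mulgA (mulg_rwl3 eE) (mulg_rwl ee).
split; last exact: leM_trans (leM_mull x _) (leM_mulr e r).
by exists (e * r), x; rewrite -!mulgA (mulg_rwl3 eE) eE ee.
Qed.

(** By [idemJ_mulr], e t = e t f1 for an idempotent f1 of the J-class, and f1 e f = f1 f. *)
Lemma idem_insert e t f : e * e = e -> leM e t -> idemJ e f ->
  e * t * e * f = e * t * f.
Proof.
move=> ee et ef; have [f1 ef1 <-] := idemJ_mulr ee et.
by rewrite -!mulgA (mulgA f1) (idemJ_mid ee ef1 (idemJ_refl ee) ef).
Qed.

(** Since t' e = f t' e for an idempotent f of the J-class, [idem_insert] removes the inner e. With
    [idem_sandwichV], the elements e t e with t J-above e form a group. *)
Lemma idem_sandwichM e t t' : e * e = e -> leM e t -> leM e t' ->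
  e * t * e * (e * t' * e) = e * (t * t') * e.
Proof.
move=> ee et et'; have [f ef fE] := idemJ_mull ee et'.
have := congr1 (fun z => z * (t' * e)) (idem_insert ee et ef).
by rewrite -!mulgA fE (mulg_rwl ee).
Qed.

Lemma idem_sandwichV e t : e * e = e -> leM e t ->
  exists2 y, leM e y & e * y * e * (e * t * e) = e.
Proof.
move=> ee et; set x := e * t * e; have xE : x = e * t * e by []; clearbody x.
have ex : leM e x.
  by rewrite xE; apply: leM_mul => //; [apply: leM_mul => //|]; exact: leM_refl.
have [r [rxr er]] := ge_idem_inverse ee ex.
have [rx _] := inverse_idemJ rxr er.
exists r; first by case: er.
rewrite -[RHS](idemJ_absorb (idemJ_refl ee) rx).
by rewrite xE -!mulgA ?ee !(mulg_rwl ee) ?ee.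
Qed.

(** From e = a x b and x = p e q, the group elements [al] and [be] satisfy [al * be = e], hence also
    [be * al = e]. Inserting the latter into p e q shows that b e a is an inverse of x. *)
Lemma eqJ_regular e x : e * e = e -> eqJ e x -> exists y, x * y * x = x.
Proof.
move=> ee [[a [b eE]] [p [q xE]]].
pose al := e * (a * p) * e; pose be := e * (q * b) * e.
have ab : al * be = e.
  rewrite /al /be -!mulgA !(mulg_rwl ee) -[RHS]ee -[X in _ = X * _]ee.
  by rewrite [in X in _ = _ * X * _]eE xE !mulgA.
have eap : leM e (a * p) by exists e, (e * be); rewrite mulgA ab.
have [y _ yal] := idem_sandwichV ee eap.
have ybe : e * y * e = be.
  have -> : e * y * e = e * y * e * (al * be) by rewrite ab -!mulgA ee.
  by rewrite mulgA yal /be -!mulgA (mulg_rwl ee).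
have ba : be * al = e by rewrite -ybe.
exists (b * e * a); have <- : p * (be * al) * q = x by rewrite ba -xE.
by rewrite {1 2}ba /be /al -!mulgA !(mulg_rwl ee).
Qed.

Lemma eqJ_idem_factor e x : e * e = e -> eqJ e x ->
  exists f g, [/\ idemJ e f, idemJ e g, f * x = x & x * g = x].
Proof.
move=> ee ex; have [y xyx] := eqJ_regular ee ex.
have exy : eqJ e (x * y).
  apply: eqJ_trans ex _; split; last exact: leM_mulr.
  by rewrite -{1}xyx; exact: leM_mulr.
have eyx : eqJ e (y * x).
  apply: eqJ_trans ex _; split; last exact: leM_mull.
  by rewrite -{1}xyx -mulgA; exact: leM_mull.
by exists (x * y), (y * x); split=> //; rewrite ?mulgA // /idemJ; split=> //;
  rewrite !mulgA ?xyx // -!mulgA (mulgA x) xyx.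
Qed.

End Orthodox.

(** * Adjoining an identity *)

Section AdjoinOne.
Variable S : semigroupType.

(** A new identity is added even to a monoid, so that the value 1 singles out the empty word (see
    [mul_eq1] and [wev_eq1]). *)
Definition adj1 : Type := option S.
HB.instance Definition _ := Choice.on adj1.

Definition emb (x : S) : adj1 := Some x.

Definition adj1_mul (a b : adj1) : adj1 :=
  match a, b with
  | Some x, Some y => Some (x * y)
  | None, _ => b
  | _, None => a
  end.

Lemma adj1_mulA : associative adj1_mul.
Proof. by move=> [x|] [y|] [z|] //=; rewrite mulgA. Qed.

Lemma adj1_mul1 : left_id None adj1_mul.
Proof. by case. Qed.

Lemma adj1_1mul : right_id None adj1_mul.
Proof. by case. Qed.

HB.instance Definition _ := isMonoid.Build adj1 adj1_mulA adj1_mul1 adj1_1mul.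

Lemma embM x y : emb (x * y) = emb x * emb y.
Proof. by []. Qed.

Lemma emb_inj : injective emb.
Proof. by move=> x y []. Qed.

Lemma adj1_cases (a : adj1) : a = 1 \/ exists x, a = emb x.
Proof. by case: a => [x|]; [right; exists x|left]. Qed.

Lemma leJP (x y : S) : leJ x y <-> leM (emb x) (emb y).
Proof.
split.
  case=> [->|[a ->]|[b ->]|[a [b ->]]].
  - exact: leM_refl.
  - by exists (emb a), 1.
  - by exists 1, (emb b).
  - by exists (emb a), (emb b).
by case=> [[a|] [[b|] [xE]]]; [apply: Or44; exists a, b|apply: Or42; exists a
  |apply: Or43; exists b|apply: Or41].
Qed.

Lemma mul_eq1 (a b : adj1) : a * b = 1 -> a = 1 /\ b = 1.
Proof. by case: a; case: b. Qed.

End AdjoinOne.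

HB.instance Definition _ (S : finSemigroup) := Finite.on (adj1 S).

Lemma JclassP (S : semigroupType) (x y : S) :
  Jclass x y <-> eqJ (emb x) (emb y).
Proof. by split=> -[/leJP ? /leJP ?]; split=> //; exact/leJP. Qed.

Lemma pvS_pseudovariety : pseudovariety pvS.
Proof. by []. Qed.

(** * Membership in DO expressed by J-equivalent idempotents *)

Section FinGroupOf.
Variables (S : finSemigroup) (e : S) (i : S -> S).
Hypotheses (el : left_id e *%g) (il : left_inverse e i *%g).

(** The two proofs are arguments of the type so that the group instance can be inferred from it. *)
Definition fin_group_of of left_id e *%g & left_inverse e i *%g : Type :=
  fsg_sort S.
Local Notation G := (fin_group_of el il).

HB.instance Definition _ := Finite.on G.
HB.instance Definition _ :=
  @Finite_isGroup.Build G (@fsg_op S) e i (@fsg_opA S) el il.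

Definition fin_group_val (x : G) : S := x.

Lemma fin_group_valM : {morph fin_group_val : x y / x * y}.
Proof. by []. Qed.

HB.instance Definition _ := isMultiplicative.Build G S fin_group_val fin_group_valM.

End FinGroupOf.

Lemma is_group_finGroup (S : finSemigroup) : is_group S ->
  exists (G : finGroupType) (f : {multiplicative G -> S}), bijective f.
Proof.
move=> [e [i [el il]]]; exists (fin_group_of el il).
by exists (@fin_group_val S e i el il); exists id.
Qed.

(** In the product of a rectangular band and a group, the idempotents are the pairs (b, 1), and b c
    b = b. *)
Lemma DO_orthodox (S : finSemigroup) : DO S -> orthodox (adj1 S).
Proof.
move=> SDO [e|] [f|] //; last by move=> _ _ [[[a|] [[b|]]]].
move=> [ee] [ff] ef.
have [|B [G [F [[_ BB] Finj FE]]]] := SDO e; first by exists e; rewrite !ee.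
have [p _ pe] : range F e by rewrite FE; apply/JclassP; exact: eqJ_refl.
have [q _ qf] : range F f by rewrite FE; exact/JclassP.
have idem r : F r * F r = F r -> r.2 = 1.
  rewrite -gmulfM => /Finj/(congr1 snd)/= rr.
  by apply: (mulgI r.2); rewrite mulg1.
congr Some; rewrite /= -pe -qf -!gmulfM; congr (F _).
have p1 : p.2 = 1 by apply: idem; rewrite pe.
have q1 : q.2 = 1 by apply: idem; rewrite qf.
case: p p1 {pe} => b g /= ->; case: q q1 {qf} => c h /= ->.
by congr (_, _); rewrite /= ?BB ?mulg1.
Qed.

(** The set on the right is closed under products by [leM_mul], and [idem_sandwichV] supplies left
    inverses. *)
Lemma maximal_subgroup (S : finSemigroup) (e : S) :
    orthodox (adj1 S) -> e * e = e ->
  exists (t : table) (f : {multiplicative t -> S}),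
    [/\ is_group t, injective f & range f = [set g | e * g * e = g /\ leJ e g]].
Proof.
move=> So ee; set E := emb e; have EE : E * E = E by rewrite -embM ee.
have [tG [fG [_ fGinj fGE]]] : exists (t : table) (f : {multiplicative t -> S}),
    [/\ pvS t, injective f & range f = [set g | e * g * e = g /\ leJ e g]].
  apply: sub_table => //.
    by exists e; rewrite /= !ee; split=> //; apply/leJP; exact: leM_refl.
  move=> g h [gE /leJP eg] [hE /leJP eh]; split; last first.
    by apply/leJP; rewrite embM; exact: leM_mul.
  by rewrite -gE -hE -!mulgA !(mulg_rwl ee) ee.
have GP g : e * fG g * e = fG g /\ leJ e (fG g).
  by have : range fG (fG g) by [exists g]; rewrite fGE.
have [e0 e0E] : exists e0, fG e0 = e.
  have : range fG e by rewrite fGE /= !ee; split=> //; apply/leJP; exact: leM_refl.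
  by case=> e0 _ <-; exists e0.
exists tG, fG; split=> //.
  have /choice[i iP] g : exists h, h * g = e0.
    have [gE /leJP /(idem_sandwichV So EE)[z Ez]] := GP g.
    have [w wE] : exists w, E * z * E = emb w.
      by case: z {Ez} => [z|]; [exists (e * z * e)|exists (e * e)].
    rewrite wE /E -!embM gE => /(@emb_inj S) wg.
    have : range fG w.
      rewrite fGE; split; last first.
        by apply/leJP; rewrite -wE; do 2?[apply: leM_mul => //]; exact: leM_refl.
      by apply: (@emb_inj S); rewrite 2!embM -wE -!mulgA EE !(mulg_rwl EE).
    by case=> h _ hE; exists h; apply: fGinj; rewrite gmulfM hE e0E.
exists e0, i; split=> // g; apply: fGinj.
by rewrite gmulfM e0E; have [<- _] := GP g; rewrite -!mulgA !(mulg_rwl ee).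
Qed.

(** Coordinates on the J-class of an idempotent e: [tB] is the band of idempotents J-equivalent to
    e, [G] is the maximal subgroup at e, and (b, g) is sent to b g b. *)
Lemma orthodox_DO (S : finSemigroup) : orthodox (adj1 S) -> DO S.
Proof.
move=> So x [y xE].
have [e [ee Ex]] : exists e, e * e = e /\ eqJ (emb e) (emb x).
  exists (x * y); split; first by rewrite mulgA -xE.
  rewrite embM; split; first exact: leM_mulr.
  by rewrite {1}xE 2!embM; exact: leM_mulr.
set E := emb e in Ex; have EE : E * E = E by rewrite -embM ee.
have JE z : Jclass x z <-> eqJ E (emb z).
  split=> [/JclassP|] xz; first exact: eqJ_trans xz.
  by apply/JclassP; apply: eqJ_trans xz; exact: eqJ_sym.
have EEJ := idemJ_refl EE.
have Jmul u v : eqJ E u -> eqJ E v -> eqJ E (u * v).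
  move=> [Eu uE] [Ev vE]; split; first exact: leM_mul.
  exact: leM_trans (leM_mulr _ _) uE.
have [tB [fB [_ fBinj fBE]]] : exists (t : table) (f : {multiplicative t -> S}),
    [/\ pvS t, injective f & range f = [set b | idemJ E (emb b)]].
  apply: sub_table => //.
    by exists e.
  by move=> b c /= Eb Ec; rewrite embM; exact: idemJ_mul.
have [tG [fG [tGG fGinj fGE]]] := maximal_subgroup So ee.
have BP b : idemJ E (emb (fB b)).
  by have : range fB (fB b) by [exists b]; rewrite fBE.
have GP g : e * fG g * e = fG g /\ leJ e (fG g).
  by have : range fG (fG g) by [exists g]; rewrite fGE.
have [e0 e0E] : exists e0, fG e0 = e.
  have : range fG e by rewrite fGE /= !ee; split=> //; apply/leJP; exact: leM_refl.
  by case=> e0 _ <-; exists e0.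
have [G [h [h' hK h'K]]] := is_group_finGroup tGG.
pose k (g : G) : S := fG (h g).
have kM g g' : k (g * g') = k g * k g' by rewrite /k !gmulfM.
have kE g : e * k g * e = k g by case: (GP (h g)).
have ke g : e * k g = k g by rewrite -[in LHS]kE -!mulgA (mulg_rwl ee) mulgA kE.
have ek g : k g * e = k g by rewrite -[in LHS]kE -!mulgA ee mulgA kE.
have k1 : k 1 = e.
  by rewrite -(ek 1) /k -{1}e0E -(h'K e0) -gmulfM -gmulfM mul1g h'K.
have mid a b c : idemJ E (emb a) -> idemJ E (emb b) -> idemJ E (emb c) ->
    a * (b * c) = a * c.
  move=> aP bP cP; rewrite mulgA; apply: (@emb_inj S); rewrite !embM.
  exact: (idemJ_mid So EE).
have eP : idemJ E (emb e) by [].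
have bb b b' : fB b * (fB b' * e) = fB b * e by exact: mid.
have bb' b b' : e * (fB b * fB b') = e * fB b' by exact: mid.
have ebe b : e * (fB b * e) = e by rewrite mid.
pose F (p : tB * G) : S := fB p.1 * k p.2 * fB p.1.
have FM : {morph F : p q / p * q}.
  move=> [b g] [b' g']; rewrite /F /= kM !gmulfM.
  have tl : k g' * (fB b * fB b') = k g' * fB b'.
    by rewrite -(ek g') -!mulgA bb'.
  have hd w : fB b * (fB b' * (k g * w)) = fB b * (k g * w).
    by rewrite -(ke g) -!mulgA (mulg_rwl3 (bb b b')) -mulgA.
  have ins w : k g * (fB b * (fB b' * (k g' * w))) = k g * (k g' * w).
    rewrite -(ek g) -(ke g') -!mulgA (mulg_rwl3 (bb b b')) -mulgA.
    by rewrite (mulg_rwl3 (ebe b)) (mulg_rwl ee).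
  by rewrite -!mulgA ins hd tl.
have eFe p : e * F p * e = k p.2.
  rewrite /F -(ek p.2) -(ke p.2) -!mulgA ebe.
  by rewrite (mulg_rwl3 (ebe p.1)) ek ke.
have eJB b : fB b * (e * fB b) = fB b.
  by rewrite mid //; apply: (@emb_inj S); rewrite embM; case: (BP b).
have ge g g' b w : g * g' = 1 -> k g * (fB b * (k g' * w)) = e * w.
  move=> gg'; have yE : k g * k g' = e by rewrite -kM gg' k1.
  rewrite -(ek g) -(ke g') -!mulgA (mulg_rwl3 (ebe b)) (mulg_rwl (ke _)).
  by rewrite (mulg_rwl yE).
(* Equal values have equal group components by [eFe]; cancelling these compares the band components,
   here on the left and in [Fr] on the right. *)
have Fl p q : F p = F q -> fB p.1 = fB q.1 * fB p.1.
  move=> Fpq; have kpq : k p.2 = k q.2 by rewrite -!eFe Fpq.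
  have -> : fB q.1 * fB p.1 = F q * (k p.2^-1 * fB p.1).
    by rewrite /F -!mulgA -kpq ge ?mulgV // mid.
  by rewrite -Fpq /F -!mulgA ge ?mulgV // eJB.
have Fr p q : F p = F q -> fB p.1 = fB p.1 * fB q.1.
  move=> Fpq; have kpq : k p.2 = k q.2 by rewrite -!eFe Fpq.
  have -> : fB p.1 * fB q.1 = fB p.1 * (k p.2^-1 * F q).
    by rewrite /F -!mulgA -kpq ge ?mulVg // mid.
  by rewrite -Fpq /F -!mulgA ge ?mulVg // eJB.
pose f : {multiplicative (tB * G)%type -> S} :=
  HB.pack F (isMultiplicative.Build _ _ _ FM).
exists tB, G, f; split.
- split=> [b|b c]; apply: fBinj; rewrite !gmulfM -?mulgA ?mid //;
    by apply: (@emb_inj S); rewrite embM; case: (BP b).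
- move=> p q fpq; have Fpq : F p = F q := fpq.
  have := eFe p; rewrite Fpq eFe => /fGinj/(can_inj hK) pq2.
  have := Fr q p (esym Fpq); rewrite -(Fl p q Fpq) => /fBinj pq1.
  by case: p q pq1 pq2 {fpq Fpq} => [b g] [c h0] /= -> ->.
apply/seteqP; split=> [_ [p _ <-]|z /JE Ez].
  apply/JE; rewrite /f /= /F !embM; apply: (Jmul _ _); first apply: (Jmul _ _).
  - by case: (BP p.1).
  - have [_ /leJP ?] := GP (h p.2); split=> //; rewrite -(kE p.2) -mulgA embM.
    exact: leM_mulr.
  - by case: (BP p.1).
(* Surjectivity: as z = f1 z f2, the pair (f1 f2, e z e) is sent to z. *)
have [f1 [f2 [Ef1 Ef2 f1z zf2]]] := eqJ_idem_factor So EE Ez.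
have emb_of u : idemJ E u -> exists v, u = emb v.
  by case: u => [v|]; [exists v|case=> _ [_ [[a|] [[b|]]]]].
have [f1' f1E] := emb_of _ Ef1; have [f2' f2E] := emb_of _ Ef2.
have [b _ bE] : range fB (f1' * f2').
  by rewrite fBE /= embM -f1E -f2E; exact: idemJ_mul.
have [g _ gE] : range fG (e * z * e).
  rewrite fGE; split; first by rewrite -!mulgA !(mulg_rwl ee) ee.
  apply/leJP; rewrite !embM; do 2?[apply: leM_mul => //]; try exact: leM_refl.
  by case: Ez.
exists (b, h' g) => //; apply: (@emb_inj S).
rewrite /f /= /F /= /k h'K bE gE !embM -f1E -f2E -/E.
have l : f1 * f2 * E * f1 = f1.
  rewrite (idemJ_mid So EE (idemJ_mul So EE Ef1 Ef2) EEJ Ef1).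
  exact: idemJ_absorb Ef1 Ef2.
have r : f2 * (E * (f1 * f2)) = f2.
  rewrite mulgA (idemJ_mid So EE Ef2 EEJ (idemJ_mul So EE Ef1 Ef2)) mulgA.
  exact: idemJ_absorb Ef2 Ef1.
by rewrite -{1}zf2 -{1}f1z !mulgA l f1z -!mulgA r zf2.
Qed.

(** * Closure of DO under subsemigroups, products and opposites *)

Definition mkmul (S T : semigroupType) (f : S -> T)
    (fM : {morph f : x y / x * y}) : {multiplicative S -> T} :=
  HB.pack f (isMultiplicative.Build _ _ _ fM).

Definition sg_orthodox (S : semigroupType) := forall e f : S,
  e * e = e -> f * f = f -> leJ e f -> leJ f e -> e * f * e = e.

Lemma orthodox_adj1 (S : semigroupType) : orthodox (adj1 S) <-> sg_orthodox S.
Proof.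
split=> So e f.
  move=> ee ff /leJP ef /leJP fe; apply: (@emb_inj S).
  by rewrite !embM; apply: So => //; rewrite -embM ?ee ?ff.
case: e => [e|]; case: f => [f|] //.
- move=> /(@emb_inj S) ee /(@emb_inj S) ff [/leJP ef /leJP fe].
  exact: (congr1 (@emb S) (So _ _ ee ff ef fe)).
- by move=> _ _ [[[a|] [[b|]]]].
Qed.

Lemma DO_sg_orthodox (S : finSemigroup) : DO S <-> sg_orthodox S.
Proof.
rewrite -orthodox_adj1; split; [exact: DO_orthodox|exact: orthodox_DO].
Qed.

Lemma leJ_morph (S T : semigroupType) (h : {multiplicative S -> T}) x y :
  leJ x y -> leJ (h x) (h y).
Proof.
case=> [->|[a ->]|[b ->]|[a [b ->]]]; rewrite ?gmulfM.
- exact: Or41.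
- by apply: Or42; exists (h a).
- by apply: Or43; exists (h b).
- by apply: Or44; exists (h a), (h b).
Qed.

Lemma DO_sub (S T : finSemigroup) (f : {multiplicative T -> S}) :
  injective f -> DO S -> DO T.
Proof.
move=> finj /DO_sg_orthodox So; apply/DO_sg_orthodox => e g ee gg eg ge.
by apply: finj; rewrite !gmulfM So -?gmulfM ?ee ?gg //; exact: leJ_morph.
Qed.

Lemma DO_prod (S T : finSemigroup) : DO S -> DO T -> DO (prodsg S T).
Proof.
move=> /DO_sg_orthodox So /DO_sg_orthodox To; apply/DO_sg_orthodox.
have fstM : {morph (fst : prodsg S T -> S) : x y / x * y} by [].
have sndM : {morph (snd : prodsg S T -> T) : x y / x * y} by [].
pose pi1 : {multiplicative prodsg S T -> S} :=
  mkmul fstM.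
pose pi2 : {multiplicative prodsg S T -> T} :=
  mkmul sndM.
move=> e f ee ff ef fe.
have e1 : pi1 (e * f * e) = pi1 e.
  by rewrite !gmulfM So -?gmulfM ?ee ?ff //; exact: leJ_morph.
have e2 : pi2 (e * f * e) = pi2 e.
  by rewrite !gmulfM To -?gmulfM ?ee ?ff //; exact: leJ_morph.
by rewrite [RHS]surjective_pairing [LHS]surjective_pairing; congr (_, _).
Qed.

Section Opposite.
Variable S : finSemigroup.

Lemma opp_mulA : associative (fun x y : S => y * x).
Proof. by move=> x y z; rewrite mulgA. Qed.

Definition oppsg : finSemigroup := FinSemigroup opp_mulA (fsg_inh S).

Lemma oppM (x y : S) : (x : oppsg) * (y : oppsg) = (y * x : S) :> S.
Proof. by []. Qed.

Lemma leJ_opp (x y : S) : leJ (x : oppsg) (y : oppsg) -> leJ x y.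
Proof.
case=> [->|[a ->]|[b ->]|[a [b ->]]]; [exact: Or41|by apply: Or43; exists a
  |by apply: Or42; exists b|apply: Or44].
by exists b, a; rewrite -mulgA.
Qed.

Lemma DO_opp : DO S -> DO oppsg.
Proof.
move=> /DO_sg_orthodox So; apply/DO_sg_orthodox => e f ee ff ef fe.
have := So e f ee ff (leJ_opp ef) (leJ_opp fe).
by rewrite -[in X in X -> _]mulgA.
Qed.

Lemma is_group_opp : is_group S -> is_group oppsg.
Proof.
move=> /is_group_finGroup[G [f [g fK gK]]].
exists (f 1), (fun x => f (g x)^-1); split=> x.
  by rewrite oppM -[x]gK -gmulfM mulg1.
by rewrite oppM -{1}[x]gK -gmulfM mulgV.
Qed.

(** The embedding is inversion, which reverses products. *)
Lemma is_group_opp_inj : is_group S ->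
  exists f : {multiplicative S -> oppsg}, injective f.
Proof.
move=> /is_group_finGroup[G [f [g fK gK]]].
pose h (x : S) : oppsg := f (g x)^-1.
have hM : {morph h : x y / x * y}.
  move=> x y; rewrite /h oppM.
  have -> : g (x * y) = g x * g y by rewrite -{1}[x]gK -{1}[y]gK -gmulfM fK.
  by rewrite invMg gmulfM.
pose h' : {multiplicative S -> oppsg} := mkmul hM.
exists h' => x y.
by move=> /(can_inj fK)/invg_inj/(can_inj gK).
Qed.

End Opposite.

Lemma is_group_quo (G T : finSemigroup) (f : {multiplicative G -> T}) :
  (forall t, exists x, f x = t) -> is_group G -> is_group T.
Proof.
move=> /choice[s fs] [e [i [el il]]].
exists (f e), (fun t => f (i (s t))); split=> t.
  by rewrite -{1}[t]fs -gmulfM el fs.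
by rewrite -{2}[t]fs -gmulfM il.
Qed.

(** Used to view the projections of a subgroup of a product as subgroups of the factors. *)
Lemma image_factor (S T : finSemigroup) (f : {multiplicative S -> T}) :
  exists (t : table) (q : {multiplicative S -> t}) (g : {multiplicative t -> T}),
    [/\ injective g, forall x, g (q x) = f x & forall y, exists x, q x = y].
Proof.
have [||t [g [_ ginj gE]]] := @sub_table pvS pvS_pseudovariety T (range f) I.
- by case: (fsg_inh S) => x; exists (f x); exists x.
- by move=> _ _ [x _ <-] [y _ <-]; exists (x * y); rewrite // gmulfM.
have /choice[q qE] x : exists y, g y = f x.
  by have : range f (f x) by [exists x]; rewrite -gE => -[y _ <-]; exists y.
have qM : {morph q : x y / x * y}.
  by move=> x y; apply: ginj; rewrite gmulfM !qE gmulfM.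
exists t, (mkmul qM), g; split=> // y.
have : range g (g y) by [exists y].
by rewrite gE => -[x _ xy]; exists x; apply: ginj; rewrite -xy -qE.
Qed.

(** * Closure properties of the intersection of DO and Hbar *)

Section GroupClass.
Variables (H : sgclass) (Hpv : group_pseudovariety H).
Local Notation V := (pvI DO (Hbar H)).

Lemma H_sub_V T : H T -> V T.
Proof.
case: Hpv => Hp Hg HT; split.
  apply/DO_sg_orthodox => e f ee ff _ _.
  have [G [h [k hK kK]]] := is_group_finGroup (Hg _ HT).
  have idem1 x : x * x = x -> k x = 1.
    move=> xx; apply: (mulgI (k x)); rewrite mulg1.
    by apply: (can_inj hK); rewrite gmulfM kK.
  by rewrite -[f]kK (idem1 f) // -(idem1 e) // kK !ee.
by move=> G f finj _; exact: (pv_sub Hp finj).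
Qed.

Lemma V_triv (T : finSemigroup) : #|{: T}| = 1%N -> V T.
Proof. by move=> T1; apply: H_sub_V; apply: pv_triv => //; case: Hpv. Qed.

Lemma V_sub (S T : finSemigroup) (f : {multiplicative T -> S}) :
  injective f -> V S -> V T.
Proof.
move=> finj [SDO SH]; split; first exact: (DO_sub finj SDO).
move=> G g ginj.
have fgM : {morph f \o g : x y / x * y} by move=> x y; rewrite /= !gmulfM.
exact: (SH G (mkmul fgM) (inj_comp finj ginj)).
Qed.

(** A subgroup of S x T embeds in the product of its two projections, which are subgroups of S and
    of T and so lie in [H]. *)
Lemma V_prod (S T : finSemigroup) : V S -> V T -> V (prodsg S T).
Proof.
case: Hpv => Hp _ [SDO SH] [TDO TH]; split; first exact: DO_prod.
move=> G f finj GG.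
have f1M : {morph (fun x => (f x).1) : x y / x * y} by move=> x y; rewrite gmulfM.
have f2M : {morph (fun x => (f x).2) : x y / x * y} by move=> x y; rewrite gmulfM.
pose f1 : {multiplicative G -> S} := mkmul f1M.
pose f2 : {multiplicative G -> T} := mkmul f2M.
have [t1 [q1 [g1 [g1inj g1E q1s]]]] := image_factor f1.
have [t2 [q2 [g2 [g2inj g2E q2s]]]] := image_factor f2.
have Ht : H (prodsg t1 t2).
  apply: (pv_prod Hp); [apply: (SH _ g1)|apply: (TH _ g2)] => //;
    exact: is_group_quo GG.
pose q x : prodsg t1 t2 := (q1 x, q2 x).
have qM : {morph q : x y / x * y} by move=> x y; rewrite /q !gmulfM.
apply: (pv_sub Hp (f := mkmul qM)) Ht => x y.
move=> [q1xy q2xy]; apply: finj.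
rewrite [f x]surjective_pairing [f y]surjective_pairing.
by congr (_, _); [rewrite -[LHS]g1E q1xy g1E|rewrite -[LHS]g2E q2xy g2E].
Qed.

(** If G embeds in the opposite of S, then the opposite of G embeds in S, and inversion embeds G in
    its opposite. *)
Lemma V_opp (S : finSemigroup) : V S -> V (oppsg S).
Proof.
case: Hpv => Hp _ [SDO SH]; split; first exact: DO_opp.
move=> G f finj GG.
have fM : {morph (f : oppsg G -> S) : x y / x * y}.
  by move=> x y; rewrite oppM gmulfM.
have HG : H (oppsg G).
  apply: (SH _ (mkmul fM)) => //.
  exact: is_group_opp.
by have [h hinj] := is_group_opp_inj GG; exact: (pv_sub Hp hinj).
Qed.

End GroupClass.

(** * Recording the factorization at the first occurrence of a letter *)

Section FirstOccurrence.
Variables (T : finSemigroup) (a : T).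
Local Notation carrier := (fsg_sort T + adj1 T * adj1 T)%type.

(** [inl s] stands for words of value s that avoid a fixed letter of value [a]; [inr (u, v)] stands
    for words whose parts before and after the first occurrence of that letter have the values u and
    v. *)
Definition focc_mul (x y : carrier) : carrier :=
  match x, y with
  | inl s, inl t => inl (s * t)
  | inl s, inr (u, v) => inr (emb s * u, v)
  | inr (u, v), inl t => inr (u, v * emb t)
  | inr (u, v), inr (u', v') => inr (u, v * u' * emb a * v')
  end.

Lemma focc_mulA : associative focc_mul.
Proof.
move=> [s|[u v]] [s'|[u' v']] [s''|[u'' v'']] //=; rewrite ?embM ?mulgA //.
Qed.

Definition focc : finSemigroup :=
  @FinSemigroup carrier _ focc_mulA (inhabits (inl a)).

Definition focc_val1 (x : focc) : adj1 T :=
  match x with inl s => emb s | inr (u, v) => u * emb a * v end.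

(** [focc_val1 x] is never the adjoined identity, so [odflt] just reads it in [T]; see
    [emb_focc_val]. *)
Definition focc_val (x : focc) : T := odflt a (focc_val1 x).

Lemma emb_focc_val (x : focc) : emb (focc_val x) = focc_val1 x.
Proof. by rewrite /focc_val; case: x => [s|[[u|] [v|]]]. Qed.

Lemma focc_val1M (x y : focc) : focc_val1 (x * y) = focc_val1 x * focc_val1 y.
Proof.
case: x y => [s|[u v]] [s'|[u' v']]; rewrite -[LHS]/(focc_val1 (focc_mul _ _)) /=;
by rewrite ?embM ?mulgA.
Qed.

Lemma focc_valM : {morph focc_val : x y / x * y}.
Proof.
by move=> x y; apply: (@emb_inj T); rewrite embM !emb_focc_val focc_val1M.
Qed.

Definition focc_pi := mkmul focc_valM.

(** Comparing components on both sides determines x from its value in [T]: [focc_val] is injective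
    on the elements with a given left unit of this form. *)
Lemma focc_absorb u v (x : focc) : (inr (u, v) : focc) * x = x ->
  x = inr (u, v * emb (focc_val x)).
Proof.
move=> xE; have {xE} : focc_mul (inr (u, v)) x = x := xE.
rewrite emb_focc_val; case: x => [s|[u' v']] //= -[uu vv].
by rewrite -{1}vv uu -!mulgA.
Qed.

Definition focc_avoids (x : focc) : bool := if x is inl _ then true else false.

Lemma focc_avoidsM (x y : focc) :
  focc_avoids (x * y) = focc_avoids x && focc_avoids y.
Proof. by case: x y => [s|[u v]] [s'|[u' v']]. Qed.

Lemma leJ_avoids (x y : focc) : leJ x y -> focc_avoids x -> focc_avoids y.
Proof.
by case=> [->|[b ->]|[b ->]|[b [c ->]]] //; rewrite !focc_avoidsM;
  [case/andP|case/andP|case/andP => /andP[]].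
Qed.

Lemma leJ_inl s t : leJ (inl s : focc) (inl t : focc) -> leJ s t.
Proof.
case=> [[->]|[[b|[u v]] []]|[[b|[u v]] []]|[[b|[u v]] [[c|[u' v']] []]]] //.
- exact: Or41.
- by move=> ->; apply: Or42; exists b.
- by move=> ->; apply: Or43; exists b.
- by move=> ->; apply: Or44; exists b, c.
Qed.

(** If e is [inr (u, v)], it is a left unit of both e f e and e, which have the same value in [T],
    and [focc_absorb] applies. If e is [inl s], then f, being J-above e, also lies in the copy of
    [T]. *)
Lemma DO_focc : DO T -> DO focc.
Proof.
move=> /DO_sg_orthodox To; apply/DO_sg_orthodox => e f ee ff ef fe.
have val_efe : focc_val (e * f * e) = focc_val e.
  rewrite -[focc_val _]/(focc_pi _) !gmulfM.
  by rewrite To -?gmulfM ?ee ?ff //; exact: leJ_morph.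
case: e ee ef fe val_efe => [s|[u v]] ee ef fe val_efe.
  case: f ff ef fe val_efe (leJ_avoids ef isT) => // t ff ef fe _ _.
  case: ee => ee; case: ff => ff.
  exact: (congr1 inl (To _ _ ee ff (leJ_inl ef) (leJ_inl fe))).
rewrite [RHS](focc_absorb ee) -val_efe; apply: focc_absorb.
by rewrite !mulgA ee.
Qed.

(** [focc_val] is injective on every subgroup: by [focc_absorb] if its identity is some
    [inr (u, v)]; otherwise all its elements are J-above an element of the copy of [T], hence in
    that copy. *)
Lemma Hbar_focc H : Hbar H T -> Hbar H focc.
Proof.
move=> TH G f finj GG.
have fM : {morph focc_val \o f : x y / x * y}.
  by move=> x y; rewrite /= gmulfM focc_valM.
apply: (TH G (mkmul fM) _ GG).
move=> x y fxy'; have {fxy'} fxy : focc_val (f x) = focc_val (f y) := fxy'.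
apply: finj.
have [G' [h [k hK kK]]] := is_group_finGroup GG.
have one z : f (h 1) * f z = f z by rewrite -gmulfM -[z]kK -gmulfM mul1g.
case E : (f (h 1)) => [s|[u v]]; last first.
  rewrite E in one; rewrite [LHS](focc_absorb (one x)) [RHS](focc_absorb (one y)).
  by rewrite fxy.
have avoids z : focc_avoids (f z).
  apply: (@leJ_avoids (inl s)) => //; apply: Or43; exists (f (h (k z)^-1)).
  by rewrite -E -gmulfM -{1}[z]kK -gmulfM mulgV.
case: (f x) (f y) (avoids x) (avoids y) fxy => [t|//] [t'|//] _ _ tt'.
exact: (congr1 inl (tt' : t = t')).
Qed.

End FirstOccurrence.

(** * Values of words *)

Section Words.
Variable A : finType.

Definition wev (T : semigroupType) (g : A -> T) (w : seq A) : adj1 T :=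
  \prod_(a <- w) emb (g a).

Section Eval.
Variables (T : semigroupType) (g : A -> T).

Lemma wev_nil : wev g [::] = 1. Proof. exact: big_nil. Qed.

Lemma wev_cons a w : wev g (a :: w) = emb (g a) * wev g w.
Proof. exact: big_cons. Qed.

Lemma wev_cat v w : wev g (v ++ w) = wev g v * wev g w.
Proof. exact: big_cat. Qed.

Lemma wev_seq1 a : wev g [:: a] = emb (g a).
Proof. exact: big_seq1. Qed.

Lemma wev_eq1 w : wev g w = 1 -> w = [::].
Proof. by case: w => // a w; rewrite wev_cons => /mul_eq1[]. Qed.

Lemma wev_neq0 w : w != [::] -> exists t, wev g w = emb t.
Proof.
by case: (adj1_cases (wev g w)) => // /wev_eq1 ->.
Qed.

End Eval.

Lemma eq_wev (T : semigroupType) (g h : A -> T) w :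
  {in w, g =1 h} -> wev g w = wev h w.
Proof. by move=> gh; apply: eq_big_seq => a /gh ->. Qed.

Definition adj1_map (S T : semigroupType) (h : S -> T) : adj1 S -> adj1 T := omap h.

Lemma adj1_mapM (S T : semigroupType) (h : {multiplicative S -> T}) :
  {morph adj1_map h : x y / x * y}.
Proof. by move=> [x|] [y|] //; rewrite -[LHS]/(emb (h (x * y))) gmulfM. Qed.

Lemma wev_map (S T : semigroupType) (h : {multiplicative S -> T}) (g : A -> S) w :
  adj1_map h (wev g w) = wev (h \o g) w.
Proof.
elim: w => [|a w IHw]; first by rewrite !wev_nil.
by rewrite !wev_cons adj1_mapM IHw.
Qed.

Lemma wev_opp (T : finSemigroup) (g : A -> T) w :
  wev (g : A -> oppsg T) w = wev g (rev w) :> adj1 T.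
Proof.
elim: w => [|a w IHw]; first by rewrite /rev /= !wev_nil.
rewrite wev_cons rev_cons -cats1 wev_cat wev_seq1 -IHw.
by case: (wev _ w).
Qed.

Section EvalFocc.
Variables (T : finSemigroup) (g : A -> T) (a : A).

Definition focc_gen (b : A) : focc (g a) :=
  if b == a then inr (1, 1) else inl (g b).

Lemma wev_focc u v : a \notin u ->
  wev focc_gen (u ++ a :: v) = emb (inr (wev g u, wev g v) : focc (g a)).
Proof.
have hv : wev focc_gen (a :: v) = emb (inr (1, wev g v) : focc (g a)).
  elim/last_ind: v => [|v b IHv]; first by rewrite wev_seq1 wev_nil /focc_gen eqxx.
  rewrite -cats1 -cat_cons wev_cat IHv wev_seq1 wev_cat wev_seq1 /focc_gen.
  case: eqVneq => [->|ba]; last by [].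
  by rewrite -embM -[_ * _]/(inr (1, wev g v * 1 * emb (g a) * 1) : focc (g a)) !mulg1.
elim: u => [|b u IHu] /=; first by rewrite hv wev_nil.
rewrite inE negb_or eq_sym => /andP[ba /IHu IH].
by rewrite !wev_cons IH /focc_gen (negbTE ba).
Qed.

Lemma wev_focc_notin w : a \notin w ->
  wev focc_gen w = adj1_map (inl : T -> focc (g a)) (wev g w).
Proof.
elim: w => [|b w IHw] /=; first by rewrite !wev_nil.
rewrite inE negb_or eq_sym => /andP[ba /IHw IH].
by rewrite !wev_cons IH /focc_gen (negbTE ba); case: (wev g w).
Qed.

End EvalFocc.

End Words.

(** * Relations on words recognized by a class of semigroups *)

Section Recognizable.
Variable A : finType.
Implicit Types (V : sgclass) (R : seq A -> seq A -> Prop) (u v w : seq A).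

(** [R] only has to contain the kernel of an evaluation of words in a member of [V]; it may fail to
    be an equivalence. *)
Definition recog V R := exists (T : finSemigroup) (g : A -> T),
  V T /\ forall w w', wev g w = wev g w' -> R w w'.

Lemma recog_mono V W R R' : (forall T, V T -> W T) ->
  (forall w w', R w w' -> R' w w') -> recog V R -> recog W R'.
Proof.
move=> VW RR' [T [g [VT gR]]]; exists T, g; split; first exact: VW.
by move=> w w' /gR/RR'.
Qed.

Section Products.
Variable V : sgclass.
Hypothesis V1 : forall T : finSemigroup, #|{: T}| = 1%N -> V T.
Hypothesis VM : forall S T, V S -> V T -> V (prodsg S T).

Lemma recog_true : recog V (fun _ _ => True).
Proof.
have oneA : associative (fun _ _ : unit => tt) by [].
exists (FinSemigroup oneA (inhabits tt)), (fun=> tt); split=> //.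
by apply: V1; rewrite card_unit.
Qed.

Lemma recog_and R R' : recog V R -> recog V R' ->
  recog V (fun w w' => R w w' /\ R' w w').
Proof.
move=> [S [g [VS gR]]] [T [h [VT hR]]].
have fstM : {morph (fst : prodsg S T -> S) : x y / x * y} by [].
have sndM : {morph (snd : prodsg S T -> T) : x y / x * y} by [].
exists (prodsg S T), (fun a => (g a, h a)); split; first exact: VM.
move=> w w' ww'; split.
  by apply: gR; have /= := congr1 (adj1_map (mkmul fstM)) ww'; rewrite !wev_map.
by apply: hR; have /= := congr1 (adj1_map (mkmul sndM)) ww'; rewrite !wev_map.
Qed.

Lemma recog_forall (J : finType) (R : J -> seq A -> seq A -> Prop) :
  (forall j, recog V (R j)) -> recog V (fun w w' => forall j, R j w w').
Proof.
move=> VR; have : recog V (fun w w' => forall j, j \in enum J -> R j w w').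
  elim: (enum J) => [|j s IHs].
    by apply: recog_mono recog_true.
  apply: recog_mono (recog_and (VR j) IHs) => // w w' [Rj Rs] k.
  by rewrite inE => /orP[/eqP->|/Rs].
by apply: recog_mono => // w w' ww' j; apply: ww'; rewrite mem_enum.
Qed.

End Products.

Lemma first_occurrence (a : A) w : a \in w ->
  exists u v, w = u ++ a :: v /\ a \notin u.
Proof.
elim: w => // b w IHw; case: (eqVneq a b) => [<- _|ab].
  by exists [::], w.
rewrite inE (negbTE ab) => /= /IHw[u [v [-> au]]].
by exists (b :: u), v; rewrite inE negb_or ab.
Qed.

(** When the word grows on the right, the factorization moves exactly when the appended letter is
    new. *)
Lemma last_new_letter w : w != [::] -> exists u a v,
  [/\ w = u ++ a :: v, a \notin u & {subset w <= a :: u}].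
Proof.
elim/last_ind: w => // w b IHw _; have [bw|bw] := boolP (b \in w).
  have [|u [a [v [wE au wu]]]] := IHw; first by case: w bw {IHw}.
  exists u, a, (rcons v b); split=> //; first by rewrite wE rcons_cat.
  by move=> c; rewrite mem_rcons inE => /orP[/eqP->|/wu//]; exact: wu.
exists w, b, [::]; split=> //; first by rewrite cats1.
by move=> c; rewrite mem_rcons.
Qed.

Definition left_split R w w' := forall a u v u' v',
  w = u ++ a :: v -> w' = u' ++ a :: v' -> a \notin u -> a \notin u' ->
  R u u' /\ R v v'.

Definition right_split R w w' := forall a u v u' v',
  w = u ++ a :: v -> w' = u' ++ a :: v' -> a \notin v -> a \notin v' ->
  R u u' /\ R v v'.

Definition all_related (I : Type) R (w : I -> seq A) := forall i j, R (w i) (w j).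

(** The letter is read off the single word [w i0]. It serves every index because the prefixes before
    its first occurrence are related by [R] and so have equal contents. *)
Lemma left_extract (I : Type) R (w : I -> seq A) : inhabited I ->
  (forall u v, R u v -> u =i v) ->
  all_related R w -> all_related (left_split R) w -> (forall i, w i != [::]) ->
  exists a (u v : I -> seq A), [/\ forall i, w i = u i ++ a :: v i,
    forall i, a \notin u i, forall i, {subset w i <= a :: u i},
    all_related R u & all_related R v].
Proof.
move=> [i0] RE Rw Lw w0.
have [u0 [a [v0 [w0E au0 wu0]]]] := last_new_letter (w0 i0).
have /choice[uv uvP] i : exists p : seq A * seq A,
    w i = p.1 ++ a :: p.2 /\ a \notin p.1.
  have [|u [v [wE au]]] := @first_occurrence a (w i); last by exists (u, v).
  by rewrite (RE _ _ (Rw i i0)) w0E mem_cat inE eqxx orbT.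
exists a, (fun i => (uv i).1), (fun i => (uv i).2); split=> [i|i|i|i j|i j].
- by case: (uvP i).
- by case: (uvP i).
- have [wE au] := uvP i; have [Ru _] := Lw i i0 _ _ _ _ _ wE w0E au au0.
  move=> c; rewrite (RE _ _ (Rw i i0)) => /wu0.
  by rewrite !inE -(RE _ _ Ru).
- have [[wE au] [wE' au']] := (uvP i, uvP j).
  by case: (Lw i j _ _ _ _ _ wE wE' au au').
- have [[wE au] [wE' au']] := (uvP i, uvP j).
  by case: (Lw i j _ _ _ _ _ wE wE' au au').
Qed.

Lemma right_extract (I : Type) R (w : I -> seq A) : inhabited I ->
  (forall u v, R u v -> u =i v) ->
  all_related R w -> all_related (right_split R) w -> (forall i, w i != [::]) ->
  exists a (u v : I -> seq A), [/\ forall i, w i = u i ++ a :: v i,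
    forall i, a \notin v i, forall i, {subset w i <= a :: v i},
    all_related R u & all_related R v].
Proof.
move=> I0 RE Rw Lw w0.
have rev0 u : (rev u != [::]) = (u != [::]) by rewrite -!size_eq0 size_rev.
have [||||a [u [v [wE au wu Ru Rv]]]] :=
    @left_extract I (fun w w' => R (rev w) (rev w')) (fun i => rev (w i)) I0.
- by move=> u v /RE uv c; rewrite -mem_rev uv mem_rev.
- by move=> i j; rewrite !revK.
- move=> i j a u v u' v' /(canRL revK) wE /(canRL revK) wE' au au'.
  rewrite rev_cat rev_cons cat_rcons in wE; rewrite rev_cat rev_cons cat_rcons in wE'.
  by have [||] := Lw i j _ _ _ _ _ wE wE'; rewrite ?mem_rev.
- by move=> i; rewrite rev0.
exists a, (fun i => rev (v i)), (fun i => rev (u i)); split=> // i.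
- by rewrite -[w i]revK wE rev_cat rev_cons cat_rcons.
- by rewrite mem_rev.
- by move=> c; have := wu i c; rewrite !inE !mem_rev.
Qed.

End Recognizable.

(** * Relations recognized by the intersection of DO and Hbar *)

Section RecognizableDO.
Variables (A : finType) (H : sgclass) (Hpv : group_pseudovariety H).
Local Notation V := (pvI DO (Hbar H)).
Implicit Types R : seq A -> seq A -> Prop.

Lemma recog_rev R : recog V R -> recog V (fun w w' => R (rev w) (rev w')).
Proof.
move=> [T [g [VT gR]]]; exists (oppsg T), g; split; first exact: V_opp.
by move=> w w' ww'; apply: gR; rewrite -[LHS]wev_opp -[RHS]wev_opp.
Qed.

(** The value of a word in [focc (g a)] contains the values of its parts around the first occurrence
    of a; a product over all letters a treats them together. *)
Lemma recog_left_split R : recog V R -> recog V (left_split R).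
Proof.
move=> [T [g [[TDO TH] gR]]].
suff : recog V (fun w w' => forall a u v u' v',
    w = u ++ a :: v -> w' = u' ++ a :: v' -> a \notin u -> a \notin u' ->
    R u u' /\ R v v') by [].
apply: recog_forall; [exact: V_triv|exact: V_prod|move=> a].
exists (focc (g a)), (focc_gen g a); split.
  by split; [exact: DO_focc|exact: Hbar_focc].
move=> w w' ww' u v u' v' wE w'E au au'; move: ww'.
by rewrite wE w'E !wev_focc // => /(@emb_inj (focc (g a)))[/gR ? /gR ?].
Qed.

Lemma recog_right_split R : recog V R -> recog V (right_split R).
Proof.
move=> /recog_rev/recog_left_split/recog_rev.
apply: recog_mono => // w w' ww' a u v u' v' wE w'E av av'.
have [] := ww' a (rev v) (rev u) (rev v') (rev u').
- by rewrite wE rev_cat rev_cons cat_rcons.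
- by rewrite w'E rev_cat rev_cons cat_rcons.
- by rewrite mem_rev.
- by rewrite mem_rev.
by rewrite !revK.
Qed.

(** Whether a occurs is visible in [focc (g a)], for any member [T] of the class. *)
Lemma recog_content : recog V (fun w w' : seq A => w =i w').
Proof.
suff : recog V (fun w w' : seq A => forall a, (a \in w) = (a \in w')) by [].
apply: recog_forall; [exact: V_triv|exact: V_prod|move=> a].
have [T [g [[TDO TH] _]]] := recog_true A (V_triv Hpv).
exists (focc (g a)), (focc_gen g a); split.
  by split; [exact: DO_focc|exact: Hbar_focc].
have disj w w' : a \in w -> a \notin w' ->
    wev (focc_gen g a) w <> wev (focc_gen g a) w'.
  move=> /first_occurrence[u [v [-> au]]] /wev_focc_notin->.
  by rewrite wev_focc //; case: (wev g w').
move=> w w' ww'; have [aw|aw] := boolP (a \in w);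
  have [aw'|aw'] := boolP (a \in w') => //.
  by case: (disj w w').
by case: (disj w' w).
Qed.

End RecognizableDO.

(** * Approximation of pseudowords by words, and compactness *)

Lemma coordM V A (i : evaluation V A) :
  {morph (fun x : pfree V A => coord i x) : x y / x * y}.
Proof. by []. Qed.

Lemma gen_words_wev V A (u : pfree V A) : gen_words u ->
  exists w, forall (T : semigroupType) (h : {multiplicative pfree V A -> T}),
    wev (h \o @pfree_gen V A) w = emb (h u).
Proof.
elim=> [a|x y _ [v vE] _ [w wE]].
  by exists [:: a] => T h; rewrite wev_seq1.
by exists (v ++ w) => T h; rewrite wev_cat vE wE gmulfM.
Qed.

(** Over an empty alphabet, every endomorphism of a table would fix the coordinate of x there, but
    the swap of the two-element left zero semigroup has no fixed point. *)
Lemma pseudoword_alphabet A (x : pseudoword A) : inhabited A.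
Proof.
have [a|A0] := pickP (@predT A); first by split.
have lzA : associative (fun k _ : 'I_2 => k) by [].
pose i := @Evaluation pvS A (Table lzA) I (fun=> ord0).
have swM : {morph (fun k : i => tperm ord0 ord_max k : i) : k l / k * l} by [].
have : mkmul swM (coord i x) = coord i x.
  by apply: coord_hom => a; have := A0 a.
rewrite /mkmul /= => /eqP; move: (coord i x : 'I_2) => k.
by case: tpermP => [->|->|/eqP + /eqP]; rewrite ?eqxx // => + +; case: k => [[|[|]]].
Qed.

Section Approximation.
Variables (A : finType) (S : finSemigroup).
Variable phi : {multiplicative pseudoword A -> S}.
Hypothesis phic : continuous (phi : pseudoword A -> discrete_topology S).

Lemma nbhs_hom (z : pseudoword A) : exists i : evaluation pvS A,
  forall y, coord i y = coord i z -> phi y = phi z.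
Proof.
have /(nbhs_pfree pvS_pseudovariety)[i iP] : nbhs z [set y | phi y = phi z].
  by apply: (@phic z [set phi z]); exact: (@discrete_set1 (discrete_topology S)).
by exists i.
Qed.

Lemma approx (z : pseudoword A) (i j : evaluation pvS A) : exists w,
  [/\ wev (phi \o @pfree_gen pvS A) w = emb (phi z),
      wev (ev_fun i) w = emb (coord i z) & wev (ev_fun j) w = emb (coord j z)].
Proof.
have [a] := pseudoword_alphabet z.
have [k kP] := nbhs_hom z.
have [l lP] := ev_join pvS_pseudovariety i j.
have [m mP] := ev_join pvS_pseudovariety k l.
have [u /gen_words_wev[w wE] uz] := coord_gen_words pvS_pseudovariety a m z.
have [/kP pu /lP[iu ju]] := mP _ _ uz.
exists w; split; first by rewrite wE pu.
  by rewrite -iu; exact: (wE _ (mkmul (@coordM _ _ i))).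
by rewrite -ju; exact: (wE _ (mkmul (@coordM _ _ j))).
Qed.

Definition omega_pw (z : pseudoword A) : pseudoword A :=
  interp (mkpfree omega_subproof) (fun=> z).

(** Near [omega_pw z], [phi] depends on one coordinate i only, in which the omega power is the power
    with exponent the factorial of [#|i|]. *)
Lemma hom_omega_pw (z : pseudoword A) :
  exists2 n, (0 < n)%N & phi (omega_pw z) = sgexp (phi z) n.
Proof.
have [i iP] := nbhs_hom (omega_pw z).
exists (#|{: i}|)`!; first exact: fact_gt0.
rewrite -sgexp_morph; apply/esym/iP.
exact: (sgexp_morph (mkmul (@coordM _ _ i))).
Qed.

Lemma image_ultra (T U : Type) (f : T -> U) (F : set_system T) :
  UltraFilter F -> UltraFilter (f @ F).
Proof.
move=> FU; have FF : ProperFilter F by exact: ultra_proper.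
split=> [|G GF FG]; first exact: fmap_proper_filter; apply/seteqP; split=> // B GB.
have [//|nB] := in_ultra_setVsetC (f @^-1` B) FU.
have : G (~` B) by apply: FG.
by move=> /(filterI GB); rewrite setICr => /filter_not_empty.
Qed.

(** The solutions [Z j] for single evaluations converge, for each index separately, along one
    ultrafilter that contains all sets of evaluations finer than a given one. Continuity passes the
    two properties to the limits. *)
Lemma compact_lift (H : sgclass) (Hpv : pseudovariety H) (I : Type) (y : I -> S) :
  (forall j : evaluation H A, exists z : I -> pseudoword A,
    (forall i, phi (z i) = y i) /\
    forall i i', coord (ev_forget j) (z i) = coord (ev_forget j) (z i')) ->
  exists z : I -> pseudoword A, (forall i, phi (z i) = y i) /\
    forall i i', pfree_proj H (z i) = pfree_proj H (z i').
Proof.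
move=> /choice[Z ZP].
pose finer (k j : evaluation H A) := forall x x' : pfree H A,
  coord k x = coord k x' -> coord j x = coord j x'.
pose F : set_system (evaluation H A) :=
  [set W | exists j, forall k, finer k j -> W k].
have FF : ProperFilter F.
  split; first by case=> j /(_ j); apply.
  split.
  - pose one := fun _ _ : 'I_1 => ord0 : 'I_1.
    have oneA : associative one by [].
    have Hone : H (Table oneA) by apply: (pv_triv Hpv); rewrite card_ord.
    by exists (@Evaluation H A (Table oneA) Hone (fun=> ord0)).
  - move=> W W' [j jW] [j' jW']; have [k kjj'] := ev_join Hpv j j'.
    by exists k => l lk; split; [apply: jW|apply: jW'] => x x' /lk/kjj'[].
  - by move=> W W' WW' [j jW]; exists j => k /jW/WW'.
have [U [UU FU]] := ultraFilterLemma FF.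
have UF : ProperFilter U by exact: ultra_proper.
have /choice[z zP] i : exists z, (fun j => Z j i) @ U --> (z : pseudoword A).
  have := @pfree_compact pvS A pvS_pseudovariety; rewrite compact_ultra.
  case/(_ ((fun j => Z j i) @ U) (image_ultra _ UU) (@filterT _ U _)) => z [_ zU].
  by exists z.
exists z; split=> [i|i i'].
  have : U [set j | phi (Z j i) = phi (z i)].
    apply: (zP i [set x | phi x = phi (z i)]); apply: (@phic (z i) [set phi (z i)]).
    exact: (@discrete_set1 (discrete_topology S)).
  by case/filter_ex => j <-; case: (ZP j).
apply: pfree_ext => j.
have Uj l : U [set k | coord (ev_forget j) (Z k l) = coord (ev_forget j) (z l)].
  apply: (zP l [set x | coord (ev_forget j) x = coord (ev_forget j) (z l)]).
  apply: (@coord_continuous _ _ _ (z l) [set coord (ev_forget j) (z l)]).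
  exact: (@discrete_set1 (discrete_topology (ev_forget j))).
have : U [set k | finer k j] by apply: FU; exists j.
move=> /(filterI (Uj i))/(filterI (Uj i'))/filter_ex[k [/= ki' [ki kj]]].
have [_ Zk] := ZP k.
have := kj (pfree_proj H (Z k i)) (pfree_proj H (Z k i')) (Zk i i').
by move=> kE; apply: etrans (esym ki) (etrans kE ki').
Qed.

End Approximation.

(** Says that z is a limit of words over [B], in the form needed below: [DO_sandwich] compares an
    evaluation in a semigroup with one in its maximal subgroup. *)
Definition alphabet_in (A : finType) (B : {pred A}) (z : pseudoword A) :=
  forall i j : evaluation pvS A, exists w : seq A,
    [/\ {subset w <= B}, wev (ev_fun i) w = emb (coord i z)
      & wev (ev_fun j) w = emb (coord j z)].

(** The map t |-> E t E takes products of letters of [B] to products in the maximal subgroup at E,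
    which lies in [H]. So E z E depends only on the image of z over [H], and E z F = E z E F. *)
Lemma DO_sandwich (A : finType) (H : sgclass) (T : table) (h : A -> T)
    (B : {pred A}) (E F : T) (z z' : pseudoword A) :
  DO T -> Hbar H T -> E * E = E -> F * F = F -> leJ E F -> leJ F E ->
  (forall b, b \in B -> leJ E (h b)) ->
  alphabet_in B z ->
  alphabet_in B z' ->
  pfree_proj H z = pfree_proj H z' ->
  let i := @Evaluation pvS A T I h in
  E * coord i z * F = E * coord i z' * F.
Proof.
move=> /DO_orthodox To TH EE FF EF FE EB zB z'B zz' i.
have [t [f [tG finj fE]]] := maximal_subgroup To EE.
have EEe : emb E * emb E = emb E by rewrite -embM EE.
have EFe : idemJ (emb E) (emb F).
  by split; [rewrite -embM FF|split; exact/leJP].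
(* [k x] is E x E read in the table of the subgroup, with an arbitrary value if x is not J-above
   E. *)
have /choice[k kP] x : exists k, leJ E x -> f k = E * x * E.
  have [Ex|nEx] := pselect (leJ E x); last by case: tG => e _; exists e.
  have [k _ kE] : range f (E * x * E).
    rewrite fE; split; first by rewrite -!mulgA !(mulg_rwl EE) EE.
    apply/leJP; rewrite !embM; apply: (leM_mul To) => //; last exact: leM_refl.
    by apply: (leM_mul To) => //; [exact: leM_refl|exact/leJP].
  by exists k.
have Ht : H t by exact: (TH _ f).
pose j := @Evaluation H A t Ht (fun a => k (h a)).
have main y : alphabet_in B y ->
    leJ E (coord i y) /\ E * coord i y * E = f (coord (ev_forget j) y).
  move=> /(_ i (ev_forget j))[w [wB iw jw]].
  have word (v : seq A) : {subset v <= B} -> v != [::] -> exists x l,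
      [/\ wev h v = emb x, wev (fun a => k (h a)) v = emb l, leJ E x
        & f l = E * x * E].
    elim: v => // b v IHv bvB _; have Eb := EB b (bvB b (mem_head b v)).
    have [->|v0] := eqVneq v [::].
      exists (h b), (k (h b)); rewrite !wev_seq1; split=> //; exact: kP.
    have [|x [l [vx vl Ex lE]]] := IHv _ v0.
      by move=> c cv; apply: bvB; rewrite inE cv orbT.
    exists (h b * x), (k (h b) * l); rewrite !wev_cons vx vl -!embM; split=> //.
      by apply/leJP; rewrite embM; apply: (leM_mul To) => //; exact/leJP.
    rewrite gmulfM lE kP //; apply: (@emb_inj T); rewrite !embM.
    by apply: (idem_sandwichM To) => //; exact/leJP.
  have w0 : w != [::] by case: w {wB jw} iw; rewrite ?wev_nil.
  have [x [l [wx wl Ex lE]]] := word w wB w0.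
  have -> : coord i y = x by apply: (@emb_inj T); rewrite -iw.
  have -> : coord (ev_forget j) y = l by apply: (@emb_inj t); rewrite -jw.
  by [].
have insert y : leJ E y -> E * y * F = E * y * E * F.
  move=> Ey; apply: (@emb_inj T); rewrite !embM.
  by rewrite (idem_insert To EEe _ EFe) //; exact/leJP.
have [Ez zE] := main z zB; have [Ez' z'E] := main z' z'B.
rewrite (insert _ Ez) (insert _ Ez') zE z'E.
have := congr1 (coord j) zz'; rewrite -[LHS]/(coord (ev_forget j) z).
by rewrite -[RHS]/(coord (ev_forget j) z') => ->.
Qed.

Lemma emb_sgexp (S : semigroupType) (s : S) n :
  (0 < n)%N -> emb (sgexp s n) = emb s ^+ n.
Proof.
case: n => // n _; elim: n => // n IHn.
by rewrite sgexpS // embM IHn -expgS.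
Qed.

(** * Pseudowords generated under a signature *)

Section SigmaGen.
Variables (sigma : signature) (A : finType).

Lemma sigma_gen_mono (tau : signature) (z : pseudoword A) :
  sigma `<=` tau -> sigma_gen sigma z -> sigma_gen tau z.
Proof.
move=> st; elim=> [a|n w f sw _ IH]; first exact: sigma_gen_var.
by apply: sigma_gen_op => //; exact: st.
Qed.

Lemma sigma_gen_mul (x y : pseudoword A) : implicit_signature sigma ->
  sigma_gen sigma x -> sigma_gen sigma y -> sigma_gen sigma (x * y).
Proof.
move=> smul sx sy; pose f (k : 'I_2) := if k == ord0 then x else y.
have -> : x * y = interp (pfree_gen pvS (ord0 : 'I_2) *
    pfree_gen pvS (ord_max : 'I_2)) f.
  by rewrite interp_mul !interp_gen.
by apply: sigma_gen_op => // k; rewrite /f; case: ifP.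
Qed.

Lemma sigma_gen_omega (x : pseudoword A) : sigma omega_op ->
  sigma_gen sigma x -> sigma_gen sigma (omega_pw x).
Proof. by move=> so sx; apply: sigma_gen_op. Qed.

End SigmaGen.

(** * Lifting families of words to pseudowords with equal images *)

Section Lifting.
Variables (A : finType) (S : finSemigroup).
Variable phi : {multiplicative pseudoword A -> S}.
Hypothesis phi_oc : onto_continuous phi.
Variables (I : finType) (i0 : I).
Variables (sigma : signature) (H : sgclass).
Hypothesis sigma_mul : implicit_signature sigma.
Hypothesis Hpv : group_pseudovariety H.
Hypothesis Hred : pointlike_reducible sigma H.
Local Notation V := (pvI DO (Hbar H)).
Local Notation tau := (sigma `|` [set omega_op]).
Local Notation gen := (@pfree_gen pvS A).
Local Notation ev := (wev (phi \o gen)).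

Definition lifts (rho : signature) (W : sgclass) (y : I -> adj1 S) :=
  exists z : I -> pseudoword A, [/\ forall i, y i = emb (phi (z i)),
    forall i, sigma_gen rho (z i)
    & forall i j, pfree_proj W (z i) = pfree_proj W (z j)].

(** By compactness the hypothesis makes [range y] an [H]-pointlike set, and then reducibility
    applies to [phi]. *)
Lemma lift_H (y : I -> S) :
  (forall (T : finSemigroup) (h : A -> T), H T -> exists w : I -> seq A,
    (forall i, ev (w i) = emb (y i)) /\ forall i j, wev h (w i) = wev h (w j)) ->
  lifts sigma H (fun i => emb (y i)).
Proof.
move=> yP; have Py : pointlike H (range y).
  split; first by exists (y i0); exists i0.
  move=> A' phi' [phi's phi'c].
  (* Words over [A] are moved to the alphabet of [phi'] by choosing preimages of the values of
     letters. *)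
  have /choice[t tE] a : exists x, phi' x = phi (gen a).
    have : range phi' (phi (gen a)) by rewrite phi's.
    by case=> x _ <-; exists x.
  have [|z [zy zH]] := compact_lift phi'c (proj1 Hpv) (y := y).
    move=> j; have [w [wy wj]] := yP j (fun a => coord (ev_forget j) (t a)) (ev_in j).
    have /choice[z zE] i : exists z, wev t (w i) = emb z.
      by apply: wev_neq0; apply/eqP => w0; have := wy i; rewrite w0 wev_nil.
    exists z; split=> [i|i i'].
      apply: (@emb_inj S); rewrite -wy -[LHS]/(adj1_map phi' (emb (z i))) -zE wev_map.
      by apply: eq_wev => a _; exact: tE.
    apply: (@emb_inj j).
    have coordE k : emb (coord (ev_forget j) (z k)) =
        wev (fun a => coord (ev_forget j) (t a)) (w k).
      rewrite -[LHS]/(adj1_map (mkmul (@coordM _ _ (ev_forget j))) (emb (z k))).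
      by rewrite -zE wev_map.
    by rewrite [LHS]coordE [RHS]coordE.
  exists (range z); split.
    apply/seteqP; split=> [_ [_ [i _ <-] <-]|_ [i _ <-]]; first by exists i.
    by exists (z i) => //; exists i.
  exists (pfree_proj H (z i0)); apply/seteqP.
  split=> [_ [_ [i _ <-] <-]|_ ->]; first exact: zH.
  by exists (z i0) => //; exists i0.
have [P' [P's P'y [x P'x]]] := Hred Py phi_oc.
have /choice[z zP] i : exists z, P' z /\ phi z = y i.
  have : range y (y i) by exists i.
  by rewrite -P'y => -[z P'z <-]; exists z.
exists z; split=> [i|i|i j]; first by case: (zP i) => _ ->.
  by apply: P's; case: (zP i).
have Px k : pfree_proj H (z k) = x.
  have : (pfree_proj H @` P') (pfree_proj H (z k)) by exists (z k) => //; case: (zP k).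
  by rewrite P'x.
by rewrite !Px.
Qed.

(** There are finitely many tuples of values. For each one that does not lift, [lift_H] gives a
    semigroup of [H] ruling it out; [R] combines all of these. *)
Lemma recog_lift_H : exists R, recog H R /\
  forall w : I -> seq A, (forall i, w i != [::]) -> all_related R w ->
  lifts sigma H (fun i => ev (w i)).
Proof.
have [Hp Hg] := Hpv.
have /choice[R RP] (y : {ffun I -> S}) : exists R, recog H R /\
    forall w : I -> seq A, (forall i, ev (w i) = emb (y i)) -> all_related R w ->
    lifts sigma H (fun i => emb (y i)).
  have [ly|nly] := pselect (lifts sigma H (fun i => emb (y i))).
    by exists (fun _ _ => True); split=> //; apply: recog_true; exact: (pv_triv Hp).
  have /existsNP[T /existsNP[h]] := contra_not (@lift_H y) nly.
  rewrite not_implyE => -[HT nw].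
  exists (fun v w => wev h v = wev h w); split; first by exists T, h.
  by move=> w wy ww; case: nw; exists w.
exists (fun v w => forall y, R y v w); split.
  apply: recog_forall; [exact: (pv_triv Hp)|exact: (pv_prod Hp)|].
  by move=> y; case: (RP y).
move=> w w0 Rw.
have /choice[y yE] i : exists y, ev (w i) = emb y by exact: wev_neq0.
have [_ RyP] := RP [ffun i => y i]; have [||z [zy zs zH]] := RyP w.
- by move=> i; rewrite ffunE.
- by move=> i j; exact: Rw.
by exists z; split=> // i; rewrite yE -zy ffunE.
Qed.

Definition liftable (y : I -> adj1 S) := (forall i, y i = 1) \/
  lifts tau V y.

Lemma liftable_ext (y y' : I -> adj1 S) : y =1 y' -> liftable y -> liftable y'.
Proof. by move=> /funext ->. Qed.

Lemma tau_mul : implicit_signature tau. Proof. by left. Qed.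

Lemma liftable1 : liftable (fun=> 1). Proof. by left. Qed.

Lemma liftable_mul y y' :
  liftable y -> liftable y' -> liftable (fun i => y i * y' i).
Proof.
case=> [y1|[z [yz zs zV]]]; first by apply: liftable_ext => i; rewrite y1 mul1g.
case=> [y'1|[z' [yz' zs' zV']]].
  by right; exists z; split=> // i; rewrite y'1 mulg1.
right; exists (fun i => z i * z' i); split=> [i|i|i j].
- by rewrite yz yz' gmulfM.
- by apply: sigma_gen_mul => //; exact: tau_mul.
have projM (x x' : pseudoword A) :
    pfree_proj V (x * x') = pfree_proj V x * pfree_proj V x'.
  exact: pfree_ext.
by rewrite !projM (zV i j) (zV' i j).
Qed.

Lemma liftable_gen a : liftable (fun=> emb (phi (gen a))).
Proof. by right; exists (fun=> gen a); split=> // i; exact: sigma_gen_var. Qed.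

(* phi determines the content of words, and hence that of pseudowords. *)
Hypothesis ev_content : forall w w', ev w = ev w' -> w =i w'.

(** The content condition will make the omega powers of two such families J-equivalent in the
    semigroups of [V]. *)
Definition liftable_on (B : seq A) (y : I -> adj1 S) :=
  liftable y /\ forall i, exists2 u, ev u = y i & u =i B.

Lemma liftable_on_mul B y y' :
  liftable_on B y -> liftable_on B y' -> liftable_on B (fun i => y i * y' i).
Proof.
move=> [ly yB] [ly' y'B]; split; first exact: liftable_mul.
move=> i; have [u <- uB] := yB i; have [v <- vB] := y'B i.
exists (u ++ v); first exact: wev_cat.
by move=> a; rewrite mem_cat uB vB orbb.
Qed.

Lemma liftable_on_pw B y : B != [::] -> liftable_on B y ->
  exists z : I -> pseudoword A, [/\ forall i, y i = emb (phi (z i)),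
    forall i, sigma_gen tau (z i),
    forall i j, pfree_proj V (z i) = pfree_proj V (z j)
  & forall i (j : evaluation pvS A),
      exists2 w, w =i B & wev (ev_fun j) w = emb (coord j (z i))].
Proof.
move=> B0 [[y1|[z [yz zs zV]]] yB].
  have [u + uB] := yB i0; rewrite y1 => /wev_eq1 u0.
  by case: B B0 {yB} uB => // b B _ /(_ b); rewrite u0 mem_head.
exists z; split=> // i j; have [w [wE jE _]] := approx (proj2 phi_oc) (z i) j j.
exists w => //; have [u uy uB] := yB i.
by move=> a; rewrite -uB; apply: ev_content; rewrite wE uy yz.
Qed.

(** The lift consists of x_i^omega z_i y_i^omega, with x and y lifting e and f over [V] and z
    lifting w over [H]. The exponents arise because [phi] sends an omega power to some positive
    power. *)
Lemma liftable_sandwich B (R : seq A -> seq A -> Prop) (w : I -> seq A) e f :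
  (forall w : I -> seq A, (forall i, w i != [::]) -> all_related R w ->
    lifts sigma H (fun i => ev (w i))) ->
  B != [::] -> liftable_on B e -> liftable_on B f ->
  all_related R w -> (forall i, w i =i B) ->
  exists n m : I -> nat, liftable (fun i => e i ^+ n i * ev (w i) * f i ^+ m i).
Proof.
move=> RP B0 /(liftable_on_pw B0)[x [ex xs xV xB]].
move=> /(liftable_on_pw B0)[y [fy ys yV yB]].
move=> Rw wB.
have w0 i : w i != [::].
  by case: B B0 wB {xB yB} => // b B _ /(_ i b); rewrite mem_head; case: (w i).
have [z [wz zs zH]] := RP w w0 Rw.
have /choice[n nP] i : exists n, emb (phi (omega_pw (x i))) = e i ^+ n.
  have [n n0 ->] := hom_omega_pw (proj2 phi_oc) (x i).
  by exists n; rewrite ex emb_sgexp.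
have /choice[m mP] i : exists m, emb (phi (omega_pw (y i))) = f i ^+ m.
  have [n' n0 ->] := hom_omega_pw (proj2 phi_oc) (y i).
  by exists n'; rewrite fy emb_sgexp.
exists n, m; right; exists (fun i => omega_pw (x i) * z i * omega_pw (y i)).
split=> [i|i|i j].
- by rewrite !gmulfM !embM nP mP wz.
- apply: sigma_gen_mul; first exact: tau_mul.
    apply: sigma_gen_mul; first exact: tau_mul.
      by apply: sigma_gen_omega; [right|].
    by apply: (@sigma_gen_mono sigma) => // ? ?; left.
  by apply: sigma_gen_omega; [right|].
have zB k : alphabet_in [pred b | b \in B] (z k).
  move=> l l'; have [v [vE lE l'E]] := approx (proj2 phi_oc) (z k) l l'.
  exists v; split=> // a av; rewrite -(wB k) /=.
  by rewrite (ev_content (etrans (wz k) (esym vE))).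
apply: pfree_ext => k; have [TDO TH] := ev_in k.
have xE l : coord (ev_forget k) (x l) = coord (ev_forget k) (x i).
  exact: (congr1 (coord k) (xV l i)).
have yE l : coord (ev_forget k) (y l) = coord (ev_forget k) (y i).
  exact: (congr1 (coord k) (yV l i)).
pose E := omega_pow (coord (ev_forget k) (x i)).
pose F := omega_pow (coord (ev_forget k) (y i)).
(* The outer factors do not depend on the index, since x and y have constant images over [V]. *)
suff : E * coord (ev_forget k) (z i) * F = E * coord (ev_forget k) (z j) * F.
  move=> EF; apply: (etrans (y := E * coord (ev_forget k) (z i) * F)); first by [].
  by rewrite EF /E /F -(xE j) -(yE j).
have To := DO_orthodox TDO.
have EE : E * E = E := omega_pow_idem _.
have FF : F * F = F := omega_pow_idem _.
have EEe : emb E * emb E = emb E by rewrite -embM EE.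
have FFe : emb F * emb F = emb F by rewrite -embM FF.
have omE (s : k) : exists n', omega_pow s = sgexp s n'.+1.
  by exists (#|{: k}|)`!.-1; rewrite prednK ?fact_gt0.
have below (s : k) : leM (emb (omega_pow s)) (emb s).
  have [n' ->] := omE s.
  rewrite emb_sgexp // expgS; exact: leM_mulr.
have letter (s : k) w' a : wev (ev_fun k) w' = emb s -> a \in w' ->
    leM (emb s) (emb (ev_fun k a)).
  move=> <- /first_occurrence[u [v [-> _]]]; rewrite wev_cat wev_cons.
  by exists (wev (ev_fun k) u), (wev (ev_fun k) v); rewrite mulgA.
have EB b : b \in B -> leM (emb E) (emb (ev_fun k b)).
  move=> bB; apply: leM_trans (below _) _; have [v vB vE] := xB i (ev_forget k).
  by apply: letter vE _; rewrite vB.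
have FB b : b \in B -> leM (emb F) (emb (ev_fun k b)).
  move=> bB; apply: leM_trans (below _) _; have [v vB vE] := yB i (ev_forget k).
  by apply: letter vE _; rewrite vB.
(* Elements J-above an idempotent are closed under products, so once all letters of B are J-above s,
   so is the omega power of any value of a word with content B. *)
have above (s t : k) v : emb s * emb s = emb s -> v =i B ->
    (forall b, b \in B -> leM (emb s) (emb (ev_fun k b))) ->
    wev (ev_fun k) v = emb t -> leM (emb s) (emb (omega_pow t)).
  move=> ss vB sB vt; have st : leM (emb s) (emb t).
    rewrite -vt; have : {subset v <= B} by move=> c; rewrite vB.
    elim: v {vB vt} => [_|c v IHv cvB].
      by rewrite wev_nil; exists (emb s), 1; rewrite !mulg1.
    rewrite wev_cons; apply: (leM_mul To) => //.
      by apply/sB/cvB; exact: mem_head.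
    by apply: IHv => d dv; apply: cvB; rewrite inE dv orbT.
  have [n' ->] := omE t.
  elim: n' => // n' IHn'; rewrite sgexpS // embM; exact: leM_mul.
have EF : leJ E F.
  by apply/leJP; have [v vB vE] := yB i (ev_forget k); exact: above vE.
have FE : leJ F E.
  by apply/leJP; have [v vB vE] := xB i (ev_forget k); exact: above vE.
apply: (@DO_sandwich A H k (ev_fun k) [pred b | b \in B] E F (z i) (z j)) => //.
by move=> b bB; apply/leJP; exact: EB.
Qed.

(** Each cut at a first or last occurrence costs one level, and both resulting parts are related at
    the level below. *)
Fixpoint split_iter (R : seq A -> seq A -> Prop) n : seq A -> seq A -> Prop :=
  if n is n'.+1 then fun w w' =>
    [/\ split_iter R n' w w', left_split (split_iter R n') w w'
      & right_split (split_iter R n') w w']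
  else R.

Lemma split_iter_sub R n w w' : split_iter R n w w' -> R w w'.
Proof. by elim: n => //= n IHn [/IHn]. Qed.

Lemma recog_split_iter R n : recog V R -> recog V (split_iter R n).
Proof.
move=> VR; elim: n => //= n IHn.
have VM := @V_prod H Hpv.
apply: recog_mono (recog_and VM IHn (recog_and VM (recog_left_split Hpv IHn)
  (recog_right_split Hpv IHn))) => // w w' [? [? ?]].
by split.
Qed.

Lemma content_dichotomy (v w : seq A) : {subset v <= w} ->
  v =i w \/ (size (undup v) < size (undup w))%N.
Proof.
move=> vw; have [wv|] := leqP (size (undup w)) (size (undup v)); last by right.
left=> a; have [] := uniq_min_size (undup_uniq v) _ wv.
  by move=> b; rewrite !mem_undup; exact: vw.
by move=> _ /(_ a); rewrite !mem_undup.
Qed.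

Lemma size_undup_mem (v w : seq A) : v =i w -> size (undup v) = size (undup w).
Proof. by move=> vw; apply/perm_size/perm_undup. Qed.

(* Z records the prefix and suffix values met so far. If the current pair (p, q)
   is one of them, then p = p e and q = f q for the values e, f of some factors
   of full content, and these may be replaced by their omega powers. *)
Lemma liftable_loop k (Rk RG R : seq A -> seq A -> Prop) (B : seq A) :
  (forall w : I -> seq A, all_related Rk w ->
    (forall i, (size (undup (w i)) <= k)%N) -> liftable (fun i => ev (w i))) ->
  (forall w : I -> seq A, (forall i, w i != [::]) -> all_related RG w ->
    lifts sigma H (fun i => ev (w i))) ->
  (forall w w', R w w' -> [/\ Rk w w', RG w w' & w =i w']) ->
  size (undup B) = k.+1 ->
  forall n (Z : {set {ffun I -> adj1 S} * {ffun I -> adj1 S}}),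
  (#|~: Z| <= n)%N ->
  forall (p q : I -> adj1 S) (w : I -> seq A),
  all_related (split_iter R n.*2) w -> (forall i, w i =i B) ->
  liftable p -> liftable q ->
  (forall p0 q0, (p0, q0) \in Z -> exists e f,
    [/\ liftable_on B e, liftable_on B f
      & forall i, p i = p0 i * e i /\ q i = f i * q0 i]) ->
  liftable (fun i => p i * ev (w i) * q i).
Proof.
move=> Pk PG RR sB; have B0 : B != [::] by case: (B) sB.
(* A family of factors either has full content or has fewer letters and is covered by [Pk]. *)
have small n (v : I -> seq A) : all_related (split_iter R n) v ->
    (forall i, {subset v i <= B}) ->
    (forall i, v i =i B) \/ liftable (fun i => ev (v i)).
  move=> Rv vB; have vv i j : v i =i v j by case: (RR _ _ (split_iter_sub (Rv i j))).
  have [vB0|vlt] := content_dichotomy (vB i0).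
    by left=> i a; rewrite (vv i i0).
  right; apply: Pk => [i j|i]; first by case: (RR _ _ (split_iter_sub (Rv i j))).
  by rewrite (size_undup_mem (vv i i0)) -ltnS -sB.
have side n (v : I -> seq A) a : all_related (split_iter R n) v ->
    (forall i, {subset v i <= B}) -> (forall i, a \notin v i) -> a \in B ->
    liftable (fun i => ev (v i)).
  move=> Rv vB av aB; have [vE|//] := small n v Rv vB.
  by have := av i0; rewrite vE aB.
elim=> [|n IHn] Z Zn p q w Rw wB lp lq ZP.
(* If the pair (p, q) is in [Z], then p absorbs all powers of e and q all powers of f, so
   [liftable_sandwich] finishes. When n = 0, every pair is in [Z]. *)
all: have [/ZP[e [f [eB fB pqE]]]|nZ] := boolP ((finfun p, finfun q) \in Z).
1, 3: have RGw : all_related RG w by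
  move=> i j; case: (RR _ _ (split_iter_sub (Rw i j))).
1, 2: have [n1 [m1 lm]] := liftable_sandwich PG B0 eB fB RGw wB.
1, 2: apply: liftable_ext (liftable_mul (liftable_mul lp lm) lq) => i.
1, 2: have [pE qE] := pqE i; rewrite !ffunE in pE qE.
1, 2: have pn x : p i * e i ^+ x = p i by
  elim: x => [|x IHx]; rewrite ?expg0 ?mulg1 // expgS mulgA -pE.
1, 2: have qm x : f i ^+ x * q i = q i by
  elim: x => [|x IHx]; rewrite ?expg0 ?mul1g // expgSr -mulgA -qE.
1, 2: by rewrite !mulgA pn -!mulgA qm.
  move: Zn nZ; rewrite leqn0 cards_eq0 => /eqP/setP/(_ (finfun p, finfun q)).
  by rewrite !inE => ->.
have Rcont m v v' : split_iter R m v v' -> v =i v' by move=> /split_iter_sub/RR[].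
have w0 i : w i != [::].
  by case: (B) B0 (wB i) => // b s _ /(_ b); rewrite mem_head; case: (w i).
(* One round uses two levels: a cut on the left, then one on the right of what remains. *)
rewrite doubleS in Rw.
have [||a [u [v [wE au wu Ru Rv]]]] :=
  left_extract (inhabits i0) (@Rcont n.*2.+1) _ _ w0.
- by move=> i j; case: (Rw i j).
- by move=> i j; case: (Rw i j).
have uB i : {subset u i <= B}.
  by move=> c cu; rewrite -(wB i) wE mem_cat cu.
have vB i : {subset v i <= B}.
  by move=> c cv; rewrite -(wB i) wE mem_cat inE cv !orbT.
have aB : a \in B by rewrite -(wB i0) wE mem_cat mem_head orbT.
have lu := side _ u a Ru uB au aB.
have lx : liftable (fun i => ev (u i ++ [:: a])).
  apply: liftable_ext (liftable_mul lu (liftable_gen a)) => i.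
  by rewrite wev_cat wev_seq1.
have xB : liftable_on B (fun i => ev (u i ++ [:: a])).
  split=> // i; exists (u i ++ [:: a]) => // c; apply/idP/idP.
    by rewrite mem_cat inE => /orP[/uB//|/eqP->].
  by rewrite -(wB i) => /wu; rewrite mem_cat !inE orbC.
have wxE i : ev (w i) = ev (u i ++ [:: a]) * ev (v i).
  by rewrite wE -cat_rcons -cats1 wev_cat.
have [vE|lv] := small _ v Rv vB; last first.
  apply: liftable_ext (liftable_mul (liftable_mul lp (liftable_mul lx lv)) lq) => i.
  by rewrite wxE.
have v0 i : v i != [::].
  by case: (B) B0 (vE i) => // b s _ /(_ b); rewrite mem_head; case: (v i).
have [||b [v' [t [v'E bt vt Rv' Rt]]]] :=
  right_extract (inhabits i0) (@Rcont n.*2) _ _ v0.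
- by move=> i j; case: (Rv i j).
- by move=> i j; case: (Rv i j).
have tB i : {subset t i <= B}.
  by move=> c ct; rewrite -(vE i) v'E mem_cat inE ct !orbT.
have v'B i : {subset v' i <= B}.
  by move=> c cv; rewrite -(vE i) v'E mem_cat cv.
have bB : b \in B by rewrite -(vE i0) v'E mem_cat mem_head orbT.
have lt := side _ t b Rt tB bt bB.
have ly : liftable (fun i => ev (b :: t i)).
  by apply: liftable_ext (liftable_mul (liftable_gen b) lt) => i; rewrite wev_cons.
have yB : liftable_on B (fun i => ev (b :: t i)).
  split=> // i; exists (b :: t i) => // c; apply/idP/idP.
    by rewrite inE => /orP[/eqP->|/tB].
  by rewrite -(vE i) => /vt.
have vyE i : ev (v i) = ev (v' i) * ev (b :: t i) by rewrite v'E wev_cat.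
have [v'full|lv'] := small _ v' Rv' v'B; last first.
  apply: liftable_ext (liftable_mul (liftable_mul lp (liftable_mul lx
    (liftable_mul lv' ly))) lq) => i.
  by rewrite wxE vyE.
(* The pair (p, q) was not in [Z]; adding it shrinks the complement. *)
have := IHn ((finfun p, finfun q) |: Z) _ (fun i => p i * ev (u i ++ [:: a]))
  (fun i => ev (b :: t i) * q i) v' Rv' v'full
  (liftable_mul lp lx) (liftable_mul ly lq).
move=> IH; apply: liftable_ext (IH _ _) => [i||p0 q0].
- by rewrite wxE vyE !mulgA.
- rewrite -ltnS; apply: leq_trans Zn; apply: proper_card.
  rewrite finset.setCU; apply/properP; split; first exact: finset.subsetIr.
  by exists (finfun p, finfun q); rewrite !inE ?eqxx.
(* For the pair just added, the connecting factors are those cut off in this round; for older pairs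
   they are extended by them. *)
rewrite !inE => /orP[/eqP[-> ->]|/ZP[e [f [eB fB pqE]]]].
  exists (fun i => ev (u i ++ [:: a])), (fun i => ev (b :: t i)).
  by split=> // i; rewrite !ffunE.
exists (fun i => e i * ev (u i ++ [:: a])), (fun i => ev (b :: t i) * f i).
split; [exact: liftable_on_mul|exact: liftable_on_mul|move=> i].
by have [-> ->] := pqE i; rewrite !mulgA.
Qed.

(** By induction on the number of letters. [N] counts all pairs of prefix and suffix values, so the
    loop can start with an empty [Z] and p = q = 1. *)
Lemma recog_liftable k : exists R, recog V R /\
  (forall w w', R w w' -> w =i w') /\
  forall w : I -> seq A, all_related R w ->
    (forall i, (size (undup (w i)) <= k)%N) -> liftable (fun i => ev (w i)).
Proof.
have VM := @V_prod H Hpv; have VC := recog_content A Hpv.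
elim: k => [|k [Rk [VRk [Rkc Pk]]]].
  exists (fun w w' => w =i w'); split=> //; split=> // w _ w0; left=> i.
  have := w0 i; rewrite leqn0 size_eq0 => /eqP w0i.
  case: (w i) w0i => [|a s] => [|/(congr1 (fun s => a \in s))].
    by rewrite wev_nil.
  by rewrite mem_undup mem_head.
have [RG [HRG PG]] := recog_lift_H.
have VRG : recog V RG by apply: recog_mono HRG => // T; exact: H_sub_V.
pose R w w' := [/\ Rk w w', RG w w' & w =i w'].
have VR : recog V R.
  apply: recog_mono (recog_and VM VRk (recog_and VM VRG VC)) => // w w' [? [? ?]].
  by split.
pose N := #|~: (finset.set0 : {set {ffun I -> adj1 S} * {ffun I -> adj1 S}})|.
exists (split_iter R N.*2); split; first exact: recog_split_iter.
split=> [w w' /split_iter_sub[]//|w Rw wk].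
have ww i j : w i =i w j by case: (split_iter_sub (Rw i j)).
have [wlt|] := leqP (size (undup (w i0))) k.
  apply: Pk => [i j|i]; first by case: (split_iter_sub (Rw i j)).
  by rewrite (size_undup_mem (ww i i0)).
move=> wgt; have wB : size (undup (w i0)) = k.+1.
  by apply/eqP; rewrite eqn_leq wk wgt.
apply: liftable_ext (liftable_loop Pk PG _ wB (leqnn N) Rw _
  liftable1 liftable1 _) => //.
- by move=> i /=; rewrite mul1g mulg1.
- by move=> p0 q0; rewrite inE.
Qed.

End Lifting.

(** * Refining a homomorphism so that it determines contents *)

Section Content.
Variable A : finType.

Definition content_sg : finSemigroup :=
  FinSemigroup (@finset.setUA A) (inhabits finset.set0).

Definition content_gen (a : A) : content_sg := finset.set1 a.

Lemma wev_content (w w' : seq A) : wev content_gen w = wev content_gen w' -> w =i w'.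
Proof.
pose m (x : adj1 content_sg) (a : A) :=
  if x is Some s then a \in (s : {set A}) else false.
have mE v a : m (wev content_gen v) a = (a \in v).
  elim: v => [|b v IHv]; first by rewrite wev_nil.
  rewrite wev_cons inE -IHv; case: (wev content_gen v) => [s|] /=.
    by rewrite -[LHS]/(a \in finset.set1 b :|: (s : {set A})) !inE.
  by rewrite orbF -[LHS]/(a \in finset.set1 b) inE.
by move=> ww' a; rewrite -!mE ww'.
Qed.

(* Pair phi with the content and restrict the codomain to the image. *)
Lemma content_refinement (S : finSemigroup)
    (phi : {multiplicative pseudoword A -> S}) : onto_continuous phi ->
  exists (S' : finSemigroup) (psi : {multiplicative pseudoword A -> S'}),
    [/\ onto_continuous psi, forall x y, psi x = psi y -> phi x = phi y
      & forall w w', wev (psi \o @pfree_gen pvS A) w =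
                     wev (psi \o @pfree_gen pvS A) w' -> w =i w'].
Proof.
move=> [phis phic].
have [c [cc cgen]] := pfree_extend content_gen pvS_pseudovariety I.
pose th x : prodsg S content_sg := (phi x, c x).
have thM : {morph th : x y / x * y} by move=> x y; rewrite /th !gmulfM.
have [s0 _] : range phi !=set0.
  by rewrite phis; case: (fsg_inh S) => s; exists s.
have [x0 _ _] : range phi s0 by rewrite phis.
have [||t [f [_ finj fE]]] := @sub_table pvS pvS_pseudovariety _ (range th) I.
- by exists (th x0); exists x0.
- by move=> _ _ [x _ <-] [y _ <-]; exists (x * y); rewrite // thM.
have /choice[psi psiE] x : exists k, f k = th x.
  by have : range f (th x) by [rewrite fE; exists x]; case=> k _ <-; exists k.
have psiM : {morph psi : x y / x * y}.
  by move=> x y; apply: finj; rewrite gmulfM !psiE thM.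
exists t, (mkmul psiM); split.
- split.
    apply/seteqP; split=> // k _.
    have : range f (f k) by exists k.
    by rewrite fE => -[x _ xk]; exists x => //; apply: finj; rewrite -xk -psiE.
  move=> x W /nbhs_singleton Wx.
  have : nbhs x [set y | phi y = phi x /\ c y = c x].
    apply: filterI.
      by apply: (phic x [set phi x]); exact: (@discrete_set1 (discrete_topology S)).
    by apply: (cc x [set c x]); exact: (@discrete_set1 (discrete_topology content_sg)).
  apply: filterS => y [py cy]; rewrite /= /mkmul /=.
  suff -> : psi y = psi x by [].
  by apply: finj; rewrite !psiE /th py cy.
- by move=> x y xy; have := congr1 f xy; rewrite !psiE => -[].
move=> w w' ww'; apply: wev_content.
have sndM : {morph (snd : prodsg S content_sg -> content_sg) : x y / x * y} by [].
have := congr1 (adj1_map (mkmul sndM)) (congr1 (adj1_map f) ww').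
rewrite !wev_map.
have E v : wev (mkmul sndM \o (f \o (mkmul psiM \o @pfree_gen pvS A))) v =
    wev content_gen v.
  by apply: eq_wev => a _; rewrite /= psiE -cgen.
by rewrite !E.
Qed.

End Content.

(** * Pointlike sets as families of values of words *)

Theorem corollary4p2 (sigma : signature) (H : sgclass) :
  implicit_signature sigma ->
  group_pseudovariety H ->
  pointlike_reducible sigma H ->
  pointlike_reducible (sigma `|` [set omega_op]) (pvI DO (Hbar H)).
Proof.
move=> smul Hpv Hred S P [[s0 Ps0] Ppl] A phi phi_oc.
have [P' [P'P [x P'x]]] := Ppl A phi phi_oc.
(* The family is indexed by the finite set [S]; an index outside [P] receives a preimage of [s0]. *)
have /choice[zt ztP] s : exists z, P' z /\ (P s -> phi z = s).
  have PP' r : P r -> exists2 z, P' z & phi z = r by rewrite -P'P.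
  have [Ps|nPs] := pselect (P s); first by have [z] := PP' _ Ps; exists z.
  by have [z P'z _] := PP' _ Ps0; exists z; split=> // /nPs.
have [S' [psi [psi_oc psi_phi psi_content]]] := content_refinement phi_oc.
have [R [[T [h [VT hR]]] [_ Rlift]]] :=
  recog_liftable psi_oc (s0 : fsg_fin S) smul Hpv Hred psi_content #|A|.
(* As an evaluation, [T] contributes a coordinate of the free pro-V semigroup, in which all elements
   of [P'] agree; hence so do the values in [T] of the words approximating them. *)
pose j : evaluation (pvI DO (Hbar H)) A := @Evaluation _ A (table_of T)
  (V_sub (f := @tdec T) (can_inj (@tdecK T)) VT) (fun a => tenc (h a)).
have /choice[w wP] s := approx (proj2 psi_oc) (zt s) (ev_forget j) (ev_forget j).
have projx s : pfree_proj (pvI DO (Hbar H)) (zt s) = x.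
  have : (pfree_proj (pvI DO (Hbar H)) @` P') (pfree_proj (pvI DO (Hbar H)) (zt s)).
    by exists (zt s) => //; case: (ztP s).
  by rewrite P'x.
have wR : all_related R w.
  move=> s s'; apply: hR.
  have tw r : wev h (w r) = adj1_map (@tdec T) (emb (coord j x)).
    have [_ wE _] := wP r.
    rewrite -(projx r) -[coord j _]/(coord (ev_forget j) (zt r)) -wE wev_map.
    by apply: eq_wev => a _ /=; rewrite tencK.
  by rewrite !tw.
have [|w1|[z [wz zs zV]]] := Rlift w wR.
- by move=> s; rewrite -(card_uniqP (undup_uniq _)) max_card.
- by have [wE _ _] := wP s0; have := w1 s0; rewrite wE.
have phiz s : phi (z s) = phi (zt s).
  apply: psi_phi; apply: (@emb_inj S'); rewrite -wz.
  by case: (wP s).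
exists (range z); split.
- by move=> _ [s _ <-]; exact: zs.
- rewrite -P'P; apply/seteqP; split=> [_ [_ [s _ <-] <-]|_ [y P'y <-]].
    by rewrite phiz; exists (zt s) => //; case: (ztP s).
  exists (z (phi y)); first by exists (phi y).
  rewrite phiz; case: (ztP (phi y)) => _; apply.
  by rewrite -P'P; exists y.
exists (pfree_proj (pvI DO (Hbar H)) (z s0)).
apply/seteqP; split=> [_ [_ [s _ <-] <-]|_ ->]; first exact: zV.
by exists (z s0) => //; exists s0.
Qed.
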